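(* Let $\mathcal{X}$ be a finite-dimensional complex Hilbert space, let $k>1$ be an integer, and let $\mathcal{Y}=\mathcal{X}^k=\mathcal{X}\oplus\cdots\oplus\mathcal{X}$ ($k$ summands). Let $\Phi:\operatorname{span}(\mathrm{MES}_{\mathcal{X},\mathcal{Y}})\to\operatorname{span}(\mathrm{MES}_{\mathcal{X},\mathcal{Y}})$ be an invertible linear map such that $\Phi(\mathrm{MES}_{\mathcal{X},\mathcal{Y}})\subset\mathrm{MES}_{\mathcal{X},\mathcal{Y}}$. Then there exist unitary operators $U\in L(\mathcal{X})$ and $V\in L(\mathcal{Y})$ and a map $\sigma$, which is either the identity map $A^\sigma=A$ or the transpose map $A^\sigma=A^T$ on $L(\mathcal{X}\otimes\mathcal{Y})$, such that $$\Phi(X)=(U\otimes V)\,X^\sigma\,(U\otimes V)^*\qquad\text{for all }X\in\operatorname{span}(\mathrm{MES}_{\mathcal{X},\mathcal{Y}}).$$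
   Context: Let $m=\dim\mathcal{X}\ge 1$ and $n=\dim\mathcal{Y}=km$. Fix an orthonormal basis of $\mathcal{X}$, identifying $\mathcal{X}$ with $\mathbb{C}^m$; the basis of $\mathcal{Y}=\mathcal{X}^k$ is the one induced by the direct sum, and $\mathcal{X}\otimes\mathcal{Y}$ carries the product basis. Transposes are taken with respect to these bases. $L(\mathcal{V})$ denotes the space of linear operators on $\mathcal{V}$. A unit vector $u\in\mathcal{X}\otimes\mathcal{Y}$ is maximally entangled if $u=\sum_{j=1}^{m}\frac{1}{\sqrt m}\,x_j\otimes y_j$ for some orthonormal sets $\{x_1,\dots,x_m\}\subset\mathcal{X}$, $\{y_1,\dots,y_m\}\subset\mathcal{Y}$. $\mathrm{MES}_{\mathcal{X},\mathcal{Y}}=\{uu^*: u\in\mathcal{X}\otimes\mathcal{Y}\text{ maximally entangled}\}\subset L(\mathcal{X}\otimes\mathcal{Y})$. Here $\operatorname{span}$ is the complex linear span and linear means $\mathbb{C}$-linear. *)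

(* Defs.v *)
From HB Require Import structures.
From mathcomp Require Import all_boot all_order all_algebra spectral.
From mathcomp Require Import boolp classical_sets functions reals.
From mathcomp Require Import complex mxtens.

Set Implicit Arguments.
Unset Strict Implicit.
Unset Printing Implicit Defensive.

Import Order.TTheory GRing.Theory Num.Theory.
Local Open Scope classical_set_scope.
Local Open Scope ring_scope.

Definition adjoint (R : realType) (p q : nat) (A : 'M[R[i]]_(p, q)) :
    'M[R[i]]_(q, p) :=
  map_mx Num.conj A^T.

(* Orthonormality for the standard inner product of C^d (conjugate-linear in
   its first argument). *)
Definition orthonormal_family (R : realType) (m d : nat)
    (x : 'I_m -> 'cV[R[i]]_d) : Prop :=
  forall i j, (adjoint (x i) *m x j) 0 0 = (i == j)%:R.

(* X = C^m, Y = C^n and X (x) Y = C^(m * n) in the product basis, with [tensmx]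
   the Kronecker product.  [tensmx (x j) (y j)] has 1 * 1 columns, which is
   convertible to 1. *)
Definition maximally_entangled (R : realType) (m n : nat)
    (u : 'cV[R[i]]_(m * n)) : Prop :=
  exists (x : 'I_m -> 'cV[R[i]]_m) (y : 'I_m -> 'cV[R[i]]_n),
    [/\ orthonormal_family x, orthonormal_family y &
      u = \sum_(j < m) (sqrtC m%:R)^-1 *: (tensmx (x j) (y j) : 'cV_(m * n))].

Definition MES (R : realType) (m n : nat) : set 'M[R[i]]_(m * n) :=
  [set A | exists2 u : 'cV[R[i]]_(m * n),
             maximally_entangled u & A = u *m adjoint u].
Arguments MES : clear implicits.

Definition lspan (K : fieldType) (V : lmodType K) (S : set V) : set V :=
  [set v | exists (r : nat) (a : 'I_r -> K) (s : 'I_r -> V),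
             (forall i, S (s i)) /\ v = \sum_(i < r) a i *: s i].

(* Restriction of [f] to the subspace [S] is linear; the values of [f] outside
   [S] are irrelevant. *)
Definition linear_on (K : fieldType) (V W : lmodType K) (S : set V)
    (f : V -> W) : Prop :=
  forall (a : K) (u v : V), S u -> S v -> f (a *: u + v) = a *: f u + f v.

(* Main.v *)
Require Import Defs.
From HB Require Import structures.
From mathcomp Require Import all_boot all_order all_algebra spectral.
From mathcomp Require Import boolp classical_sets functions reals.
From mathcomp Require Import complex mxtens.
From mathcomp Require Import ring.

Set Implicit Arguments.
Unset Strict Implicit.
Unset Printing Implicit Defensive.

Import Order.TTheory GRing.Theory Num.Theory.
Local Open Scope classical_set_scope.
Local Open Scope ring_scope.

(**
A unit vector of X (x) Y is maximally entangled exactly when it is vec A / sqrt m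
for an isometry A : X -> Y, that is, an n x m matrix with A^* A = 1 (lemma
[MES_dyad]).  Writing [dyad A B] for (vec A) (vec B)^*, the map Phi sends every
[dyad A A] with A an isometry to some [dyad B B] of the same kind, and it has to
be shown that B = V A W, up to a phase and possibly after a global transposition.

Two isometries A, B with orthogonal ranges exist because n >= 2 m, and then
every x A + y B with |x|^2 + |y|^2 = 1 is an isometry.  So Phi restricts to a map
that sends pure states of a qubit to rank one projections, and such a map
is unitary or antiunitary: if Phi (dyad A A) = a a^* and Phi (dyad B B) = b b^*
then Phi (dyad A B) is a phase times a b^* or b a^* ([qubit_preserver],
[Phi_cross]).

Split Y = X (+) X^(k-1) and correspondingly A = up M + dn N.  Isometries span all
matrices, and they are not covered by two proper subspaces ([isometry_span],
[isometry_cover]); this makes the choice between a b^* and b a^* the same for all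
pairs (up U1, dn U2), by injectivity of Phi, and a transposition reduces to the
case a b^*.  Since linear maps that agree up to scalars on isometries are
proportional ([isometry_eigen]), the phases can be removed coherently: there is a
linear Gam with Phi (dyad A B) = dyad (Gam A) (Gam B) for A in one block and B in the
other, and for A = B an isometry in one block ([left_type_gamma]).

Orthogonality of ranges is preserved ([Phi_orth]).  Applied to c U1 + s U2 and
s U1 T - c U2 T it shows that Gam(U)^* Gam(U T) does not depend on the isometry U
inside a block; as k blocks of size m fill Y, this Gram matrix F(T) satisfies
Gam(U T) = Gam(U) F(T), so F is a unital endomorphism of the m x m matrices that
preserves unitaries, and F(T) = W T W^* ([unital_hom_inner]).  Hence
Gam A = V A W^* with V unitary ([Gam_unitary]).

Finally, for an isometry A = up M + dn N with both blocks nonzero, letting the phase of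
M vary shows that Phi (dyad A A) = dyad (Gam A') (Gam A') with A' = x up M + y dn N
and x y^* = 1; as A' is again an isometry, either |x| = 1 or M and N are
multiples of isometries, and in both cases Phi (dyad A A) = dyad (Gam A) (Gam A)
([Gam_dyad]).
*)

Local Open Scope sesquilinear_scope.

(** * Subspaces and linear maps *)

Section LinearMaps.
Variable K : fieldType.

Lemma lin0 (U V : lmodType K) (f : U -> V) : linear f -> f 0 = 0.
Proof.
move=> lf; have : f (-1 *: 0 + 0) = -1 *: f 0 + f 0 by exact: lf.
by rewrite scaler0 addr0 scaleN1r addNr.
Qed.

Lemma linZ (U V : lmodType K) (f : U -> V) a u : linear f -> f (a *: u) = a *: f u.
Proof.
move=> lf; have : f (a *: u + 0) = a *: f u + f 0 by exact: lf.
by rewrite addr0 (lin0 lf) addr0.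
Qed.

Lemma linD (U V : lmodType K) (f : U -> V) u v : linear f -> f (u + v) = f u + f v.
Proof.
move=> lf; have : f (1 *: u + v) = 1 *: f u + f v by exact: lf.
by rewrite !scale1r.
Qed.

(** Subspaces are kept as Prop-valued predicates, so that conditions such as
    an equation between values of Phi can serve as one. *)
Definition lin_closed (V : lmodType K) (P : V -> Prop) : Prop :=
  forall (a : K) u v, P u -> P v -> P (a *: u + v).

Lemma lin_closed_sum (V : lmodType K) (P : V -> Prop) (I : finType) (F : I -> V) :
  P 0 -> lin_closed P -> (forall i, P (F i)) -> P (\sum_i F i).
Proof.
move=> P0 cP PF; elim/big_rec: _ => // i x _ Px.
by rewrite -[F i]scale1r; apply: cP.
Qed.

Lemma lin_closed0 (V : lmodType K) (P : V -> Prop) u : lin_closed P -> P u -> P 0.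
Proof. by move=> cP Pu; rewrite -(addNr u) -scaleN1r; apply: cP. Qed.

Lemma lin_closedZ (V : lmodType K) (P : V -> Prop) a u :
  lin_closed P -> P u -> P (a *: u).
Proof.
by move=> cP Pu; rewrite -[_ *: _]addr0; apply: (cP) => //; exact: (lin_closed0 cP Pu).
Qed.

Lemma lspan_closed (V : lmodType K) (A : set V) : lin_closed (lspan A).
Proof.
move=> c _ _ [r1 [a1 [s1 [S1 ->]]]] [r2 [a2 [s2 [S2 ->]]]].
exists (r1 + r2)%N,
  (fun i : 'I_(r1 + r2) => match fintype.split i with inl j => c * a1 j | inr j => a2 j end),
  (fun i : 'I_(r1 + r2) => match fintype.split i with inl j => s1 j | inr j => s2 j end); split.
  by move=> i; case: (fintype.split i).
rewrite big_split_ord /= scaler_sumr; congr (_ + _); apply: eq_bigr => i _.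
  by rewrite (unsplitK (inl i : 'I_r1 + 'I_r2)%type) scalerA.
by rewrite (unsplitK (inr i : 'I_r1 + 'I_r2)%type).
Qed.

Lemma lspan_gen (V : lmodType K) (A : set V) x : A x -> lspan A x.
Proof.
move=> Ax; exists 1%N, (fun _ => 1), (fun _ => x); split=> //.
by rewrite big_ord1 scale1r.
Qed.

Lemma lspan0 (V : lmodType K) (A : set V) : lspan A 0.
Proof. by exists 0%N, (fun _ => 0), (fun _ => 0); split=> [[]//|]; rewrite big_ord0. Qed.

Lemma lspan_ind (V : lmodType K) (A : set V) (P : V -> Prop) :
  lin_closed P -> P 0 -> (forall x, A x -> P x) -> forall x, lspan A x -> P x.
Proof.
move=> cP P0 PA _ [r [a [s [As ->]]]]; apply: lin_closed_sum => // i.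
by apply: lin_closedZ => //; apply: PA.
Qed.

(** In finite dimension a subspace of largest dimension inside S exhausts S. *)
Lemma subspace_vspace (V : vectType K) (S : V -> Prop) : S 0 -> lin_closed S ->
  exists U : {vspace V}, forall v, S v <-> v \in U.
Proof.
move=> S0 Sl.
pose Q d := `[< exists2 U : {vspace V}, \dim U = d & forall v, v \in U -> S v >].
have Q0 : exists d, Q d.
  exists 0%N; apply/asboolP; exists 0%VS; first by rewrite dimv0.
  by move=> v; rewrite memv0 => /eqP ->.
have Qb d : Q d -> (d <= \dim {:V})%N.
  by move=> /asboolP[U <- _]; apply: dimvS; apply: subvf.
case: (ex_maxnP Q0 Qb) => d /asboolP[U dU SU] dmax; exists U => v; split=> [Sv|]; last exact: SU.
apply: contraT => vU; have : (\dim (U + <[v]>) <= d)%N.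
  apply: dmax; apply/asboolP; exists (U + <[v]>)%VS => // w.
  move=> /memv_addP[u uU [_ /vlineP[c ->] ->]].
  by rewrite addrC; apply: Sl => //; apply: SU.
rewrite -dU => dle; case/negP: vU.
have /eqP -> : U == (U + <[v]>)%VS by rewrite eqEdim addvSl.
exact: (subvP (addvSr _ _)) (memv_line v).
Qed.

(** Precompose with a projection onto the subspace. *)
Lemma extend_linear (V : vectType K) (W : lmodType K) (S : V -> Prop) (f : V -> W) : S 0 ->
  lin_closed S ->
  (forall a u v, S u -> S v -> f (a *: u + v) = a *: f u + f v) ->
  exists g : {linear V -> W}, forall v, S v -> g v = f v.
Proof.
move=> S0 Sl fl; have [U US] := subspace_vspace S0 Sl.
have gl : linear (fun v => f (projv U v)).
  by move=> a u v; rewrite linearP fl //; apply/US; apply: memv_proj.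
pose g : {linear V -> W} := HB.pack (fun v => f (projv U v)) (GRing.isLinear.Build K V W _ _ gl).
by exists g => v /US vU; rewrite /= projv_id.
Qed.

End LinearMaps.

(** * Conjugate transposes *)

Section Adjoint.
Variable C : numClosedFieldType.
Implicit Types (p q r : nat).

Lemma adjM p q r (A : 'M[C]_(p, q)) (B : 'M[C]_(q, r)) :
  (A *m B)^t* = B^t* *m A^t*.
Proof. by rewrite trmx_mul map_mxM. Qed.

Lemma adjD p q (A B : 'M[C]_(p, q)) : (A + B)^t* = A^t* + B^t*.
Proof. by rewrite linearD /= map_mxD. Qed.

Lemma adjB p q (A B : 'M[C]_(p, q)) : (A - B)^t* = A^t* - B^t*.
Proof. by rewrite linearB /= map_mxB. Qed.

Lemma adjZ p q (a : C) (A : 'M[C]_(p, q)) : (a *: A)^t* = a^* *: A^t*.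
Proof. by rewrite linearZ /= map_mxZ. Qed.

Lemma adj0 p q : (0 : 'M[C]_(p, q))^t* = 0.
Proof. by rewrite trmx0 map_mx0. Qed.

Lemma adj1 p : (1%:M : 'M[C]_p)^t* = 1%:M.
Proof. by rewrite trmx1 map_mx1. Qed.

Lemma adj_sum p q (I : finType) (F : I -> 'M[C]_(p, q)) :
  (\sum_i F i)^t* = \sum_i (F i)^t*.
Proof. by rewrite linear_sum /= map_mx_sum. Qed.

Lemma adj_mul_ge0 p (v : 'cV[C]_p) : 0 <= (v^t* *m v) 0 0.
Proof.
rewrite mxE sumr_ge0 // => i _; rewrite !mxE mulrC; exact: mul_conjC_ge0.
Qed.

Lemma adj_mul_eq0 p q (A : 'M[C]_(p, q)) : A^t* *m A = 0 -> A = 0.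
Proof.
move=> A0; apply/matrixP => i j; rewrite mxE.
have := congr1 (fun M : 'M_q => M j j) A0; rewrite !mxE => /eqP.
rewrite psumr_eq0 => [|k _]; last by rewrite !mxE mulrC mul_conjC_ge0.
move=> /allP/(_ i (mem_index_enum _)) /=; rewrite !mxE mulrC mul_conjC_eq0.
by move/eqP.
Qed.

Lemma mul_adj_eq0 p q (A : 'M[C]_(p, q)) : A *m A^t* = 0 -> A = 0.
Proof.
move=> A0; have : A^t* = 0 by apply: adj_mul_eq0; rewrite trmxCK.
by move/(congr1 (fun M => M^t*)); rewrite trmxCK adj0.
Qed.

Lemma gram_neq0 d (v : 'cV[C]_d) : v != 0 -> (v^t* *m v) 0 0 != 0.
Proof.
by apply: contra_neq => v0; apply: adj_mul_eq0; rewrite [LHS]mx11_scalar v0 raddf0.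
Qed.

Lemma tr_adj p q (A : 'M[C]_(p, q)) : (A^t*)^T = map_mx Num.conj A.
Proof. by apply/matrixP => i j; rewrite !mxE. Qed.

Lemma adj_conj p q (A : 'M[C]_(p, q)) : (map_mx Num.conj A)^t* = A^T.
Proof. by apply/matrixP => i j; rewrite !mxE conjCK. Qed.

Lemma eq_mul_col p q (A B : 'M[C]_(p, q)) :
  (forall x : 'cV_q, A *m x = B *m x) -> A = B.
Proof.
move=> AB; apply/matrixP => i j.
by have := congr1 (fun M : 'cV_p => M i 0) (AB (delta_mx j 0)); rewrite -!colE !mxE.
Qed.

Lemma linear_matrix p q (L : 'cV[C]_q -> 'cV[C]_p) : linear L ->
  exists W : 'M_(p, q), forall x, L x = W *m x.
Proof.
move=> lL; exists (\matrix_(i, j) L (delta_mx j 0) i 0) => x.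
have Lsum (I : finType) (G : I -> 'cV_q) : L (\sum_i G i) = \sum_i L (G i).
  by apply: (big_morph L (fun u v => linD u v lL) (lin0 lL)).
rewrite [x in LHS]matrix_sum_delta Lsum; apply/matrixP => i j; rewrite summxE mxE.
by apply: eq_bigr => k _; rewrite ord1 big_ord1 (linZ _ _ lL) !mxE mulrC.
Qed.

End Adjoint.

(** * Phases *)

Section Phases.
Variable C : numClosedFieldType.

Lemma phaseN1 : (-1 : C) * (-1)^* = 1.
Proof. by rewrite rmorphN rmorph1 mulrNN mulr1. Qed.

Lemma phasei : ('i : C) * 'i^* = 1.
Proof. by rewrite conjCi mulrN -expr2 sqrCi opprK. Qed.

Lemma phase_neq0 (l : C) : l * l^* = 1 -> l != 0.
Proof. by apply: contra_eq_neq => ->; rewrite mul0r eq_sym oner_eq0. Qed.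

Lemma oneDi_neq0 : (1 + 'i : C) != 0.
Proof.
apply/eqP => /(congr1 (fun x => x * (1 - 'i))); rewrite mul0r => /eqP.
have -> : (1 + 'i) * (1 - 'i) = 1 - 'i ^+ 2 :> C by ring.
by rewrite sqrCi opprK (_ : 1 + 1 = 2%:R) ?pnatr_eq0.
Qed.

(** The triple 3, 4, 5 avoids square roots. *)
Lemma pythagorean : exists c s : C,
  [/\ c^* = c, s^* = s, c * c + s * s = 1 & c * s != 0].
Proof.
exists (3 / 5), (4 / 5); rewrite !rmorphM !fmorphV /= !conjC_nat; split=> //.
  by field.
by rewrite !mulf_neq0 ?invr_eq0 ?pnatr_eq0.
Qed.

(** The cross terms of a form at (x, y) and at (i x, y) are independent combinations
    of Z and Z', so membership of all of them in a subspace gives that of Z. *)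
Lemma cross_terms (V : lmodType C) (Z Z' : V) (P : V -> Prop) :
  lin_closed P ->
  (forall x y, x * x^* + y * y^* = 1 -> P ((x * y^*) *: Z + (x^* * y) *: Z')) ->
  P Z.
Proof.
move=> cP H; have [c [s [cr sr cs cs0]]] := pythagorean.
have := H c s; rewrite cr sr => /(_ cs) H1.
have := H ('i * c) s; rewrite rmorphM /= conjCi cr sr => H2.
have {}H2 : P (('i * c * s) *: Z + (- 'i * c * s) *: Z').
  by apply: H2; rewrite mulrACA mulrN -expr2 sqrCi opprK mul1r.
have two0 : (2 : C) != 0 by rewrite pnatr_eq0.
have -> : Z = (2 * (c * s))^-1 *: (((c * s) *: Z + (c * s) *: Z') +
    (- 'i) *: (('i * c * s) *: Z + (- 'i * c * s) *: Z')).
  rewrite -[LHS](scalerK (mulf_neq0 two0 cs0)); congr (_ *: _).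
  rewrite scalerDr !scalerA addrACA -!scalerDl.
  have I2 : 'i * 'i = -1 :> C by rewrite -expr2 sqrCi.
  have -> : c * s + - 'i * ('i * c * s) = 2 * (c * s).
    by transitivity (c * s - ('i * 'i) * (c * s)); [ring | rewrite I2; ring].
  have -> : c * s + - 'i * (- 'i * c * s) = 0.
    by transitivity (c * s + ('i * 'i) * (c * s)); [ring | rewrite I2; ring].
  by rewrite scale0r addr0.
apply: lin_closedZ => //; rewrite addrC; exact: cP.
Qed.

End Phases.

(** * Isometries and the matrices they span *)

Section Isometries.
Variable C : numClosedFieldType.

Definition isometry p q (A : 'M[C]_(p, q)) : Prop := A^t* *m A = 1%:M.

Lemma iso_comb n m (A B : 'M[C]_(n, m)) x y :
  isometry A -> isometry B -> A^t* *m B = 0 -> x * x^* + y * y^* = 1 ->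
  isometry (x *: A + y *: B).
Proof.
move=> isoA isoB AB xy; have BA : B^t* *m A = 0.
  by rewrite -[LHS]trmxCK adjM trmxCK AB adj0.
rewrite /isometry !(adjD, adjZ, mulmxDl, mulmxDr, =^~ scalemxAl, =^~ scalemxAr).
rewrite AB BA isoA isoB !scaler0 addr0 add0r !scalerA -scalerDl.
by rewrite ![_^* * _]mulrC xy scale1r.
Qed.

Lemma iso_phase n m (A : 'M[C]_(n, m)) z : z * z^* = 1 -> isometry A -> isometry (z *: A).
Proof.
by move=> zz isoA; rewrite /isometry adjZ -scalemxAl -scalemxAr scalerA isoA mulrC zz scale1r.
Qed.

Lemma iso_mul n m q (A : 'M[C]_(n, m)) (B : 'M_(m, q)) :
  isometry A -> isometry B -> isometry (A *m B).
Proof.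
by move=> isoA isoB; rewrite /isometry adjM mulmxA -(mulmxA (B^t*)) isoA mulmx1.
Qed.

Lemma iso1 m : isometry (1%:M : 'M[C]_m).
Proof. by rewrite /isometry adj1 mulmx1. Qed.

Lemma iso_neq0 n m (A : 'M[C]_(n, m)) : (0 < m)%N -> isometry A -> A != 0.
Proof.
move=> m0 isoA; apply/eqP => A0; move: isoA; rewrite /isometry A0 mulmx0.
move=> /matrixP/(_ (Ordinal m0) (Ordinal m0)); rewrite !mxE eqxx => /eqP.
by rewrite eq_sym oner_eq0.
Qed.

Lemma conj_iso n m (A : 'M[C]_(n, m)) : isometry A -> isometry (map_mx Num.conj A).
Proof.
have E : (map_mx Num.conj A)^t* = map_mx Num.conj (A^t*) by apply/matrixP => i j; rewrite !mxE.
by move=> isoA; rewrite /isometry E -map_mxM isoA map_mx1.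
Qed.

Lemma mxtrace_adj_eq0 d (P : 'M[C]_d) : \tr (P *m P^t*) = 0 -> P = 0.
Proof.
move=> /eqP; rewrite /mxtrace psumr_eq0 => [/allP P0|i _]; last first.
  by rewrite mxE sumr_ge0 // => j _; rewrite !mxE mul_conjC_ge0.
apply/matrixP => i j; have := P0 i (mem_index_enum _); rewrite mxE /=.
rewrite psumr_eq0 => [/allP/(_ j (mem_index_enum _))|k _]; rewrite !mxE ?mul_conjC_ge0 //.
by rewrite mul_conjC_eq0 => /eqP.
Qed.

(** The sum is a self-adjoint idempotent whose trace is the full dimension. *)
Lemma frame_complete n m (I : finType) (Q : I -> 'M[C]_(n, m)) :
  (#|I| * m)%N = n -> (forall i, isometry (Q i)) ->
  (forall i j, i != j -> (Q i)^t* *m Q j = 0) ->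
  \sum_i Q i *m (Q i)^t* = 1%:M.
Proof.
move=> In isoQ orthQ; pose R := \sum_i Q i *m (Q i)^t*; rewrite -/R.
have RQ i : R *m Q i = Q i.
  rewrite /R mulmx_suml (bigD1 i) //= big1 => [|j ji]; first by rewrite -mulmxA isoQ mulmx1 addr0.
  by rewrite -mulmxA orthQ ?mulmx0.
have RR : R *m R = R.
  by rewrite {2}/R mulmx_sumr; apply: eq_bigr => i _; rewrite mulmxA RQ.
have Ra : R^t* = R by rewrite adj_sum; apply: eq_bigr => i _; rewrite adjM trmxCK.
have trR : \tr R = n%:R.
  rewrite /R raddf_sum /= (eq_bigr (fun _ => m%:R)) => [|i _].
    by rewrite sumr_const -mulrnA mulnC In.
  by rewrite mxtrace_mulC isoQ mxtrace1.
apply/eqP; rewrite eq_sym -subr_eq0; apply/eqP/mxtrace_adj_eq0.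
rewrite adjB adj1 Ra mulmxBl mul1mx mulmxBr mulmx1 RR subrr subr0.
by rewrite raddfB /= mxtrace1 trR subrr.
Qed.

(** By polarization P contains all v w^* J, and since J^* J = 1 every row r equals
    w^* J with w = J r^*, so these matrices span. *)
Lemma rank_one_span p q (J : 'M[C]_(p, q)) (P : 'M[C]_(p, q) -> Prop) :
  isometry J -> lin_closed P -> P 0 ->
  (forall v : 'cV_p, v^t* *m v = 1%:M -> P (v *m v^t* *m J)) -> forall A, P A.
Proof.
move=> isoJ cP P0 Pv A.
have Pvv (v : 'cV_p) : P (v *m v^t* *m J).
  have [->|v0] := eqVneq v 0; first by rewrite !mul0mx.
  set N := (v^t* *m v) 0 0.
  have N0 : N != 0 by exact: gram_neq0.
  have Nge : 0 <= N by exact: adj_mul_ge0.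
  have r0 : sqrtC N != 0 by rewrite sqrtC_eq0.
  have rK : (sqrtC N)^* = sqrtC N by rewrite conj_Creal // ger0_real // sqrtC_ge0.
  have -> : v *m v^t* *m J =
     N *: ((sqrtC N)^-1 *: v *m ((sqrtC N)^-1 *: v)^t* *m J).
    rewrite adjZ fmorphV /= rK -!scalemxAl -scalemxAr -scalemxAl !scalerA.
    by rewrite -invfM -expr2 sqrtCK divff // scale1r.
  apply: lin_closedZ => //; apply: Pv.
  rewrite adjZ fmorphV /= rK -scalemxAl -scalemxAr scalerA [v^t* *m v]mx11_scalar -/N.
  by rewrite -invfM -expr2 sqrtCK -[_%:M]scalemx1 scalerA mulVf // scale1r.
have Pvw (v w : 'cV_p) : P (v *m w^t* *m J).
  pose T (z : C) := (v + z *: w) *m (v + z *: w)^t* *m J.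
  have -> : v *m w^t* *m J = 4^-1 *: T 1 + ((- 4^-1) *: T (-1) +
      ((4^-1 * 'i) *: T 'i + (- (4^-1 * 'i)) *: T (- 'i))).
    rewrite /T !(adjD, adjZ, mulmxDl, mulmxDr, =^~ scalemxAl, =^~ scalemxAr).
    move: (v *m v^t* *m J) (v *m w^t* *m J) (w *m v^t* *m J) (w *m w^t* *m J).
    move=> X Y Z W; rewrite !rmorphN !rmorph1 /= conjCi.
    apply/matrixP => i j; rewrite !mxE.
    have ii : 'i * 'i = -1 :> C by rewrite -expr2 sqrCi.
    have n4 : (4 : C) != 0 by rewrite pnatr_eq0.
    rewrite -[LHS](mulKf n4).
    move: ('i : C) ii (4^-1 : C) => I0 ii f.
    move: (X i j) (Y i j) (Z i j) (W i j) => x y z w'.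
transitivity (f * ((2 - 2 * (I0 * I0)) * y + (2 + 2 * (I0 * I0)) * z)); last by ring.
    by rewrite ii; ring.
  have PT z : P (T z) by exact: Pvv.
  by do 3![apply: (cP) => //]; apply: lin_closedZ.
have -> : A = \sum_i delta_mx i (0 : 'I_1) *m (J *m (row i A)^t*)^t* *m J.
  apply/row_matrixP => i; rewrite linear_sum (bigD1 i) //= big1 ?addr0.
    rewrite -mulmxA adjM trmxCK -mulmxA isoJ mulmx1 row_mul rowE.
    rewrite mul_delta_mx (_ : delta_mx 0 0 = 1%:M :> 'M_1) ?mul1mx ?rowE //.
    by apply/matrixP => a b; rewrite !ord1 !mxE.
  move=> k ki; rewrite !row_mul rowE mul_delta_mx_0 ?mul0mx // eq_sym //.
by apply: lin_closed_sum.
Qed.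

(** Multiplication by z along the line of v, and by 1 on its complement, is unitary. *)
Lemma isometry_rot p q (J : 'M[C]_(p, q)) (v : 'cV_p) (z : C) :
  isometry J -> v^t* *m v = 1%:M -> z * z^* = 1 ->
  isometry (J + (z - 1) *: (v *m v^t* *m J)).
Proof.
move=> isoJ v1 zz.
have -> : J + (z - 1) *: (v *m v^t* *m J) =
  (1%:M + (z - 1) *: (v *m v^t*)) *m J by rewrite mulmxDl mul1mx -scalemxAl.
rewrite /isometry adjM mulmxA -(mulmxA (J^t*)).
set M := (X in _ *m X *m _); suff -> : M = 1%:M by rewrite mulmx1.
rewrite {}/M.
rewrite adjD adj1 adjZ adjM trmxCK rmorphB /= conjC1.
rewrite mulmxDl mul1mx mulmxDr mulmx1 -scalemxAl -scalemxAr.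
have -> : v *m v^t* *m (v *m v^t*) = v *m v^t*.
  by rewrite mulmxA -[v *m _ *m v]mulmxA v1 mulmx1.
rewrite scalerA -addrA -scalerDl -scalerDl.
have -> : z - 1 + (z^* - 1 + (z^* - 1) * (z - 1)) = 0.
  have -> : z - 1 + (z^* - 1 + (z^* - 1) * (z - 1)) = z * z^* - 1 by ring.
  by rewrite zz subrr.
by rewrite scale0r addr0.
Qed.

(** The difference of J and its image under the reflection in v is 2 v v^* J. *)
Lemma isometry_span p q (J : 'M[C]_(p, q)) (P : 'M[C]_(p, q) -> Prop) :
  isometry J -> lin_closed P -> (forall A, isometry A -> P A) -> forall A, P A.
Proof.
move=> isoJ cP Piso; apply: (rank_one_span isoJ) => //.
  exact/(lin_closed0 cP)/Piso/isoJ.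
move=> v v1.
have -> : v *m v^t* *m J = (- 2^-1) *: (J + (-1 - 1) *: (v *m v^t* *m J)) + 2^-1 *: J.
  by apply/matrixP => i j; rewrite !mxE; field.
apply: (cP); last exact: lin_closedZ (cP) (Piso _ isoJ).
by apply/Piso/isometry_rot => //; apply: phaseN1.
Qed.

(** Suppose that P1 misses the isometry A, so that A lies in P2.  If the rotations of A
    along v by -1 and by i were both in P1, then so would be A, a combination of them;
    hence one of them lies in P2, and its difference with A is a multiple of v v^* A. *)
Lemma isometry_cover p q (J : 'M[C]_(p, q)) (P1 P2 : 'M[C]_(p, q) -> Prop) :
  isometry J -> lin_closed P1 -> lin_closed P2 ->
  (forall A, isometry A -> P1 A \/ P2 A) -> (forall A, P1 A) \/ (forall A, P2 A).
Proof.
move=> isoJ c1 c2 cov.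
have [all1|/existsNP[A /not_implyP[isoA nP1]]] :=
  pselect (forall A, isometry A -> P1 A).
  by left; apply: (isometry_span isoJ).
right; have P2A : P2 A by case: (cov A).
apply: (rank_one_span isoA) => // [|v v1]; first exact: (lin_closed0 c2 P2A).
pose B := v *m v^t* *m A.
have P2B (z : C) : z != 1 -> P2 (A + (z - 1) *: B) -> P2 B.
  rewrite -subr_eq0 => z1 P2z; rewrite -[B](scalerK z1); apply: lin_closedZ => //.
  rewrite -[_ *: B](addrK A) addrC [_ *: B + A]addrC -scaleN1r.
  exact: c2.
have [P1a|] := cov _ (isometry_rot isoA v1 (phaseN1 C)); last first.
  by by apply: P2B; rewrite eqNr oner_eq0.
have [P1b|] := cov _ (isometry_rot isoA v1 (phasei C)); last first.
  apply: P2B; apply/eqP => /(congr1 (fun x => x ^+ 2)); rewrite sqrCi expr1n.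
  by move/eqP; rewrite eqNr oner_eq0.
case: nP1; have -> : A = (1 + 'i)^-1 *: (('i - 1) *: (A + (-1 - 1) *: B) +
    2 *: (A + ('i - 1) *: B)).
  rewrite -[LHS](scalerK (oneDi_neq0 C)); congr (_ *: _).
  by apply/matrixP => i j; rewrite !mxE; ring.
by apply: lin_closedZ (c1) (c1 _ _ _ P1a (lin_closedZ _ c1 P1b)).
Qed.

(** Comparing the ratio c of h and H at J with their ratios at two rotations of J along v
    shows that h and c H agree on B = v v^* J: otherwise H J and H B would be dependent,
    hence so would J and B, and then B inherits the ratio of J. *)
Lemma isometry_eigen p q d (J : 'M[C]_(p, q)) (h H : 'M[C]_(p, q) -> 'cV[C]_d) :
  isometry J -> linear h -> linear H -> (forall A, H A = 0 -> A = 0) ->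
  (forall A, isometry A -> exists c, h A = c *: H A) ->
  exists c, forall A, h A = c *: H A.
Proof.
move=> isoJ lh lH injH ev; have [c hJ] := ev J isoJ; exists c.
apply: (rank_one_span isoJ) => [a u v hu hv||v v1].
- by rewrite lh lH hu hv scalerDr !scalerA mulrC.
- by rewrite (lin0 lh) (lin0 lH) scaler0.
pose B := v *m v^t* *m J.
have [c1 h1] := ev _ (isometry_rot isoJ v1 (phaseN1 C)).
have [c2 h2] := ev _ (isometry_rot isoJ v1 (phasei C)).
rewrite -/B in h1 h2 *.
have lc f z : linear f -> f (J + (z - 1) *: B) = f J + (z - 1) *: f B :> 'cV[C]_d.
  by move=> lf; rewrite (linD _ _ lf) (linZ _ _ lf).
move: h1 h2; rewrite !lc // hJ.
pose k := h B - c *: H B => h1 h2.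
have k1 : (-1 - 1) *: k = (c1 - c) *: (H J + (-1 - 1) *: H B).
  rewrite [RHS]scalerBl -h1 /k; apply/matrixP => i j; rewrite !mxE; ring.
have k2 : ('i - 1) *: k = (c2 - c) *: (H J + ('i - 1) *: H B).
  rewrite [RHS]scalerBl -h2 /k; apply/matrixP => i j; rewrite !mxE; ring.
suff : k = 0 by move/eqP; rewrite subr_eq0 => /eqP.
(* eliminating k between k1 and k2 *)
have e : (('i - 1) * (c1 - c) + 2 * (c2 - c)) *: H J =
         (2 * ('i - 1) * ((c1 - c) - (c2 - c))) *: H B.
  have /eqP : ('i - 1) *: ((-1 - 1) *: k) = (-1 - 1) *: (('i - 1) *: k).
    by rewrite !scalerA mulrC.
  rewrite k1 k2 -subr_eq0 => /eqP e; apply/eqP; rewrite -subr_eq0 -e.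
  by apply/eqP/matrixP => i j; rewrite !mxE; ring.
set b := 2 * _ * _ in e; set a := _ + _ in e.
have {}e : a *: J = b *: B.
  apply/eqP; rewrite -subr_eq0; apply/eqP/injH.
  by rewrite (linD _ _ lH) -scaleNr !(linZ _ _ lH) e scaleNr subrr.
have [b0|b0] := eqVneq b 0; last first.
  have -> : k = h B - c *: H B by [].
  rewrite -[B](scalerK b0) -e !(linZ _ _ lh) !(linZ _ _ lH) hJ !scalerA.
  by apply/eqP; rewrite subr_eq0; apply/eqP; congr (_ *: _); ring.
have uw : c1 - c = c2 - c.
  move/eqP: b0; rewrite /b !mulf_eq0 pnatr_eq0 /= !subr_eq0 => /orP[|/eqP//].
  move/eqP/(congr1 (fun x => x ^+ 2)); rewrite sqrCi expr1n => /eqP.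
  by rewrite eqNr oner_eq0.
move/eqP: e; rewrite b0 scale0r scaler_eq0 => /orP[/eqP|/eqP J0]; last first.
  by rewrite /k /B J0 mulmx0 -(scale0r J) (linZ _ _ lh) (linZ _ _ lH) !scale0r scaler0 subrr.
rewrite /a uw -mulrDl => /eqP; rewrite mulf_eq0 (_ : 'i - 1 + 2 = 1 + 'i); last by ring.
rewrite (negPf (oneDi_neq0 C)) /= -uw => /eqP u0.
move/eqP: k1; rewrite u0 scale0r scaler_eq0 -opprD oppr_eq0 => /orP[|/eqP//].
by rewrite (_ : 1 + 1 = 2%:R) ?pnatr_eq0.
Qed.

End Isometries.

(** * Rank one operators *)

Section RankOne.
Variable C : numClosedFieldType.

Lemma outer_eq0 d (u w : 'cV[C]_d) : u *m w^t* = 0 -> u != 0 -> w = 0.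
Proof.
move=> uw u0; have : (u^t* *m u) 0 0 *: w^t* = 0.
  by rewrite -mul_scalar_mx -mx11_scalar -mulmxA uw mulmx0.
move/eqP; rewrite scaler_eq0 => /orP[/eqP uu|/eqP w0].
  by case/eqP: u0; apply: adj_mul_eq0; rewrite [LHS]mx11_scalar uu raddf0.
by rewrite -[w]trmxCK w0 adj0.
Qed.

Lemma outer_neq0 d (u w : 'cV[C]_d) : u != 0 -> w != 0 -> u *m w^t* != 0.
Proof. by move=> u0 w0; apply: contra_neq w0 => /outer_eq0; apply. Qed.

Lemma outer_par d (u w a k : 'cV[C]_d) :
  u *m w^t* = a *m k^t* -> w != 0 -> exists c, u = c *: a.
Proof.
move=> E w0; have N0 := gram_neq0 w0.
exists (((w^t* *m w) 0 0)^-1 * (k^t* *m w) 0 0).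
rewrite -[u in LHS](scalerK N0) -scalerA; congr (_ *: _).
by rewrite -!mul_mx_scalar -!mx11_scalar !mulmxA E.
Qed.

Lemma outer_phase d (u v : 'cV[C]_d) :
  u *m u^t* = v *m v^t* -> exists2 z, z * z^* = 1 & u = z *: v.
Proof.
move=> E; have [v0|v0] := eqVneq v 0.
  exists 1; first by rewrite conjC1 mulr1.
  by rewrite v0 scaler0; apply: mul_adj_eq0; rewrite E v0 mul0mx.
have u0 : u != 0.
  by apply: contra_neq v0 => u0; apply: mul_adj_eq0; rewrite -E u0 mul0mx.
have [z zE] := outer_par E u0; exists z => //.
move: E; rewrite zE adjZ -scalemxAl -scalemxAr scalerA => /eqP.
rewrite -subr_eq0 -[X in _ - X]scale1r -scalerBl scaler_eq0 subr_eq0.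
by rewrite (negPf (outer_neq0 v0 v0)) orbF => /eqP.
Qed.

Definition indep d (g h : 'cV[C]_d) : Prop :=
  forall x y, x *: g + y *: h = 0 -> x = 0 /\ y = 0.

Lemma indep_outer d (a b : 'cV[C]_d) :
  (forall c, a *m a^t* <> c *: (b *m b^t*)) ->
  (forall c, b *m b^t* <> c *: (a *m a^t*)) -> indep a b.
Proof.
move=> ab ba x y E; have [x0|x0] := eqVneq x 0.
  move: E; rewrite x0 scale0r add0r => /eqP; rewrite scaler_eq0.
  case/orP=> /eqP // b0; by case: (ba 0); rewrite b0 mul0mx scale0r.
case: (ab (- (x^-1 * y) * (- (x^-1 * y))^*)).
have -> : a = - (x^-1 * y) *: b.
  rewrite -[a](scalerK x0) (_ : x *: a = - (y *: b)); last first.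
    by apply/eqP; rewrite -addr_eq0 E.
  by rewrite scalerN scalerA scaleNr.
by rewrite adjZ -scalemxAl -scalemxAr scalerA.
Qed.

Lemma indep_not_par d (a b : 'cV[C]_d) l c : indep a b -> l != 0 -> l *: a <> c *: b.
Proof.
move=> ab l0 E; have [] := ab l (- c); first by rewrite scaleNr E subrr.
by move/eqP; rewrite (negPf l0).
Qed.

Lemma indep_sym d (a b : 'cV[C]_d) : indep a b -> indep b a.
Proof. by move=> ab x y; rewrite addrC => /ab[]. Qed.

Lemma indep_neq0 d (a b : 'cV[C]_d) : indep a b -> a != 0.
Proof.
move=> ab; apply/eqP => a0; apply: (indep_not_par (l := 1) (c := 0) ab).
  exact: oner_neq0.
by rewrite a0 scaler0 scale0r.
Qed.

Lemma indep_dual d (g h : 'cV[C]_d) : indep g h ->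
  exists e f : 'rV[C]_d,
    [/\ e *m g = 1%:M, e *m h = 0, f *m g = 0 & f *m h = 1%:M].
Proof.
move=> gh; have /row_freeP[B] : row_free (col_mx g^T h^T).
  apply: inj_row_free => v; rewrite -[v]hsubmxK mul_row_col.
  rewrite [lsubmx v]mx11_scalar [rsubmx v]mx11_scalar !mul_scalar_mx => vgh.
  have /gh[-> ->] : lsubmx v 0 0 *: g + rsubmx v 0 0 *: h = 0.
    by apply: trmx_inj; rewrite linearD !linearZ /= vgh trmx0.
  by rewrite !raddf0 row_mx0.
rewrite -[B]hsubmxK mul_col_row scalar_mx_block => /eq_block_mx[E1 E2 E3 E4].
exists (lsubmx B)^T, (rsubmx B)^T.
by split; apply: trmx_inj; rewrite trmx_mul trmxK ?trmx0 ?trmx1.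
Qed.

Lemma mulmx_scalar1 p q (u : 'cV[C]_p) (c : 'M[C]_1) (w : 'rV[C]_q) :
  u *m c *m w = c 0 0 *: (u *m w).
Proof. by rewrite {1}[c]mx11_scalar mul_mx_scalar -scalemxAl. Qed.

Definition form d (X : 'M[C]_d) (r s : 'rV[C]_d) : C := (r *m X *m s^t*) 0 0.

Lemma formD d (X Y : 'M[C]_d) r s : form (X + Y) r s = form X r s + form Y r s.
Proof. by rewrite /form mulmxDr mulmxDl mxE. Qed.

Lemma formZ d a (X : 'M[C]_d) r s : form (a *: X) r s = a * form X r s.
Proof. by rewrite /form -scalemxAr -scalemxAl mxE. Qed.

Lemma form_outer d (u w : 'cV[C]_d) r s :
  form (u *m w^t*) r s = (r *m u) 0 0 * ((s *m w) 0 0)^*.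
Proof.
rewrite /form mulmxA -mulmxA -adjM.
by rewrite [in LHS](mx11_scalar (r *m u)) mul_scalar_mx mxE; congr (_ * _); rewrite !mxE.
Qed.

Lemma form_adj d (X : 'M[C]_d) r s : form (X^t*) r s = (form X s r)^*.
Proof.
have -> : form (X^t*) r s = ((s *m X *m r^t*)^t*) 0 0.
  by rewrite !adjM trmxCK mulmxA.
by rewrite 2!mxE.
Qed.

Lemma form_rank_one d (v : 'cV[C]_d) r s r' s' :
  form (v *m v^t*) r s * form (v *m v^t*) r' s' =
  form (v *m v^t*) r s' * form (v *m v^t*) r' s.
Proof. by rewrite !form_outer; ring. Qed.

Lemma form_vanish d (v : 'cV[C]_d) (r : 'rV_d) :
  form (v *m v^t*) r r = 0 -> r *m v = 0.
Proof.
by rewrite form_outer => /eqP; rewrite mul_conjC_eq0 => /eqP r0; rewrite [r *m v]mx11_scalar r0 raddf0.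
Qed.

Lemma form_kill d (g w : 'cV[C]_d) (r s : 'rV_d) :
  r *m g = 0 -> form (g *m w^t*) r s = 0.
Proof. by move=> rg; rewrite form_outer rg mxE mul0r. Qed.

Lemma sum_outer_vanish d (u v : 'cV[C]_d) (X : 'M_d) (r : 'rV_d) :
  u *m u^t* + v *m v^t* = X -> form X r r = 0 -> r *m u = 0.
Proof.
move=> <-; rewrite formD => /eqP.
rewrite !form_outer paddr_eq0 ?mul_conjC_ge0 // !mul_conjC_eq0.
by case/andP=> /eqP r0 _; rewrite [r *m u]mx11_scalar r0 raddf0.
Qed.

Lemma form_dec d (X : 'M[C]_d) (g h : 'cV[C]_d) (e f : 'rV_d) :
  (g *m e + h *m f) *m X *m (g *m e + h *m f)^t* =
  form X e e *: (g *m g^t*) + form X f f *: (h *m h^t*) +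
  (form X e f *: (g *m h^t*) + form X f e *: (h *m g^t*)).
Proof.
have F (u w : 'cV_d) (r s : 'rV_d) :
    u *m r *m X *m (w *m s)^t* = form X r s *: (u *m w^t*).
  by rewrite -mulmx_scalar1 adjM !mulmxA.
rewrite adjD !(mulmxDl, mulmxDr) !F.
by apply/matrixP => i j; rewrite !mxE; ring.
Qed.

(** [e] and [f] are dual to [g] and [h], so 1 - g e - h f has rows annihilating both. *)
Lemma span_of_annihilator d (g h v : 'cV[C]_d) (e f : 'rV_d) :
  e *m g = 1%:M -> e *m h = 0 -> f *m g = 0 -> f *m h = 1%:M ->
  (forall r : 'rV_d, r *m g = 0 -> r *m h = 0 -> r *m v = 0) ->
  v = (e *m v) 0 0 *: g + (f *m v) 0 0 *: h.
Proof.
move=> eg eh fg fh kill.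
pose w := 1%:M - g *m e - h *m f.
have : w *m v = 0.
  apply/row_matrixP => i; rewrite row_mul kill ?row0 //.
    rewrite -row_mul /w !mulmxBl mul1mx -!mulmxA eg fg mulmx1 mulmx0 subrr subr0.
    by rewrite row0.
  rewrite -row_mul /w !mulmxBl mul1mx -!mulmxA eh fh mulmx1 mulmx0 subr0 subrr.
  by rewrite row0.
rewrite /w !mulmxBl mul1mx -!mulmxA => /eqP; rewrite -addrA -opprD subr_eq0 => /eqP {1}->.
by rewrite [e *m v]mx11_scalar [f *m v]mx11_scalar !mul_mx_scalar !mxE !eqxx !mulr1n.
Qed.

Lemma outer2 d (g h : 'cV[C]_d) x y :
  (x *: g + y *: h) *m (x *: g + y *: h)^t* =
  (x * x^*) *: (g *m g^t*) + (y * y^*) *: (h *m h^t*) +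
  ((x * y^*) *: (g *m h^t*) + (x^* * y) *: (h *m g^t*)).
Proof.
rewrite !(adjD, adjZ, mulmxDl, mulmxDr, =^~ scalemxAl, =^~ scalemxAr).
by apply/matrixP => i j; rewrite !mxE; ring.
Qed.

(** The 2 x 2 determinant is a trigonometric polynomial in the phase of x / y that vanishes
    identically, so its Fourier coefficients vanish; the linear ones, taken at two different
    moduli of x, give the first two equations. *)
Lemma torus_det (al be ga de al' be' ga' de' : C) :
  (forall x y, x * x^* + y * y^* = 1 ->
    (x * x^* + (x * y^* * al + x^* * y * al')) *
    (y * y^* + (x * y^* * de + x^* * y * de')) =
    (x * y^* * be + x^* * y * be') * (x * y^* * ga + x^* * y * ga')) ->
  [/\ al = 0, de = 0, be * ga = 0 & be * ga' + be' * ga = 1].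
Proof.
move=> H.
(* the equation at (c z, s), with zb standing for the conjugate of z *)
pose F c s z zb := (c * c + c * s * (z * al + zb * al')) *
  (s * s + c * s * (z * de + zb * de')) -
  c * c * s * s * ((z * be + zb * be') * (z * ga + zb * ga')).
have I2 : 'i * 'i = -1 :> C by rewrite -expr2 sqrCi.
have I0 : 'i != 0 :> C by exact: neq0Ci.
have FE c s z : c^* = c -> s^* = s -> c * c + s * s = 1 -> z * z^* = 1 ->
    F c s z z^* = 0.
  move=> cr sr cs zz; have := H (c * z) s.
  rewrite rmorphM /= cr sr.
  have -> : c * z * (c * z^*) = c * c by rewrite mulrACA zz mulr1.
  move=> /(_ cs) e; apply/eqP; rewrite /F subr_eq0; apply/eqP.
  by transitivity ((c * c + (c * z * s * al + c * z^* * s * al')) *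
    (s * s + (c * z * s * de + c * z^* * s * de'))); [ring|rewrite e; ring].
have lin c s : c^* = c -> s^* = s -> c * c + s * s = 1 -> c * s != 0 ->
    c * c * de + s * s * al = 0 /\ c * c * de' + s * s * al' = 0.
  move=> cr sr cs cs0.
  pose A := c * c * de + s * s * al; pose A' := c * c * de' + s * s * al'.
  have e1 : A + A' = 0.
    have := FE c s _ cr sr cs (phaseN1 C).
    have := FE c s 1 cr sr cs; rewrite !rmorphN /= !conjC1 mulr1 => /(_ erefl) E1 E2.
    have : F c s 1 1 - F c s (-1) (-1) = 0 by rewrite E1 E2 subrr.
    have -> : F c s 1 1 - F c s (-1) (-1) = (2 * (c * s)) * (A + A') by rewrite /F /A /A'; ring.
    by move/eqP; rewrite mulf_eq0 mulf_eq0 pnatr_eq0 (negPf cs0) /= => /eqP.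
  have e2 : A - A' = 0.
    have := FE c s _ cr sr cs (phasei C).
    have := FE c s (- 'i) cr sr cs; have -> : (- 'i)^* = 'i :> C.
      by rewrite rmorphN /= conjCi opprK.
    rewrite mulNr I2 opprK conjCi => /(_ erefl) E1 E2.
    have : F c s 'i (- 'i) - F c s (- 'i) 'i = 0 by rewrite E1 E2 subrr.
    have -> : F c s 'i (- 'i) - F c s (- 'i) 'i = (2 * (c * s)) * ('i * (A - A')).
      by rewrite /F /A /A'; ring.
    by move/eqP; rewrite !mulf_eq0 pnatr_eq0 (negPf I0) -mulf_eq0 (negPf cs0) /= => /eqP.
  have A0 : A = 0.
    apply: (mulfI (_ : 2 != 0 :> C)); rewrite ?pnatr_eq0 //.
    by rewrite mulr0 -[RHS]addr0 -{1}e1 -e2; ring.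
  by move: e1; rewrite A0 add0r.
pose c : C := 3 / 5; pose s : C := 4 / 5.
have n5 : (5 : C) != 0 by rewrite pnatr_eq0.
have cr : c^* = c by rewrite /c rmorphM fmorphV /= !conjC_nat.
have sr : s^* = s by rewrite /s rmorphM fmorphV /= !conjC_nat.
have cs : c * c + s * s = 1 by rewrite /c /s; field.
have cs0 : c * s != 0 by rewrite !mulf_neq0 ?invr_eq0 ?pnatr_eq0.
have [l1 l1'] := lin c s cr sr cs cs0.
have [l2 l2'] : s * s * de + c * c * al = 0 /\ s * s * de' + c * c * al' = 0.
  by apply: lin => //; [rewrite addrC | rewrite mulrC].
have sol u v : c * c * v + s * s * u = 0 -> s * s * v + c * c * u = 0 -> u = 0 /\ v = 0.
  move=> E1 E2; suff u0 : u = 0.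
    split=> //; move/eqP: E1; rewrite u0 mulr0 addr0 !mulf_eq0 invr_eq0 !pnatr_eq0.
    by move/eqP.
  have : (s * s) * (c * c * v + s * s * u) - (c * c) * (s * s * v + c * c * u) = 0.
    by rewrite E1 E2 !mulr0 subrr.
  have -> : (s * s) * (c * c * v + s * s * u) - (c * c) * (s * s * v + c * c * u)
    = 7 / 25 * u by rewrite /c /s; field.
  by move/eqP; rewrite !mulf_eq0 invr_eq0 !pnatr_eq0 /= => /eqP.
have [al0 de0] := sol _ _ l1 l2; have [al0' de0'] := sol _ _ l1' l2'.
have G z : z * z^* = 1 -> (z * be + z^* * be') * (z * ga + z^* * ga') = 1.
  move=> zz; apply/esym/eqP; rewrite -subr_eq0; apply/eqP.
  apply: (mulfI (_ : (c * s) * (c * s) != 0)); first by rewrite mulf_neq0.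
  rewrite mulr0 -(FE c s z cr sr cs zz) /F al0 de0 al0' de0'; ring.
have G1 : (be + be') * (ga + ga') = 1.
  by have := G 1; rewrite conjC1 !mul1r => ->.
have G2 : (be - be') * (ga - ga') = - 1.
  have := G _ (phasei C); rewrite conjCi => E; rewrite -E.
  by transitivity (- ('i * 'i * ((be - be') * (ga - ga')))); [rewrite I2|]; ring.
have two0 : (2 : C) != 0 by rewrite pnatr_eq0.
have bg' : be * ga + be' * ga' = 0.
  apply: (mulfI two0).
  transitivity ((be + be') * (ga + ga') + (be - be') * (ga - ga')); first by ring.
  by rewrite G1 G2 mulr0 subrr.
have bg : be * ga' + be' * ga = 1.
  apply: (mulfI two0).
  transitivity ((be + be') * (ga + ga') - (be - be') * (ga - ga')); first by ring.
  by rewrite G1 G2; ring.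
(* w is a phase with w ^ 2 not real, which separates the modes 2 and -2 *)
split=> //; pose w : C := c + s * 'i; pose wb : C := c - s * 'i.
have wc : w^* = wb by rewrite /w /wb rmorphD rmorphM /= cr sr conjCi mulrN.
have ww : w * wb = 1.
  by transitivity (c * c - s * s * ('i * 'i)); [rewrite /w /wb; ring|rewrite I2 mulrN1 opprK].
have := G w; rewrite wc => /(_ ww) E.
have : (w * w - wb * wb) * (be * ga) = 0.
  transitivity ((w * be + wb * be') * (w * ga + wb * ga') - w * wb * (be * ga' + be' * ga)
    - wb * wb * (be * ga + be' * ga')).
    by ring.
  by rewrite E ww bg bg' mulr0 mulr1 subr0 subrr.
have -> : w * w - wb * wb = 4 * (c * s) * 'i by rewrite /w /wb; ring.
have nz : 4 * (c * s) * 'i != 0 by rewrite mulf_neq0 // mulf_neq0 // pnatr_eq0.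
by move/eqP; rewrite mulf_eq0 (negPf nz) => /eqP.
Qed.

(** A linear map that sends pure states of a qubit to multiples of projections is induced by an
    isometry or by its composition with the transposition.  The value at (x, y) lies on the
    span of a and b, because its sum with the value at (x, - y) is a combination of a a^* and
    b b^*; there the vanishing determinant leaves one off-diagonal entry, of modulus 1. *)
Lemma qubit_preserver d (a b : 'cV[C]_d) (Z Z' : 'M_d) :
  indep a b ->
  (forall x y, x * x^* + y * y^* = 1 -> exists v : 'cV_d,
     (x * x^*) *: (a *m a^t*) + (y * y^*) *: (b *m b^t*) +
     ((x * y^*) *: Z + (x^* * y) *: Z') = v *m v^t*) ->
  exists2 l, l * l^* = 1 &
    Z = l *: (a *m b^t*) /\ Z' = l^* *: (b *m a^t*) \/
    Z = l *: (b *m a^t*) /\ Z' = l^* *: (a *m b^t*).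
Proof.
move=> ab H; have [e [f [ea eb fa fb]]] := indep_dual ab.
pose X x y := (x * x^*) *: (a *m a^t*) + (y * y^*) *: (b *m b^t*) +
     ((x * y^*) *: Z + (x^* * y) *: Z').
have XX x y : x * x^* + y * y^* = 1 -> exists p q : C,
    X x y = (p *: a + q *: b) *m (p *: a + q *: b)^t*.
  move=> xy; have [v vE] := H _ _ xy.
  have [v' vE'] : exists v' : 'cV_d, X x (- y) = v' *m v'^t*.
    by apply: H; rewrite rmorphN mulrNN.
  exists ((e *m v) 0 0), ((f *m v) 0 0); rewrite {1}/X vE -(span_of_annihilator ea eb fa fb) //.
  move=> r ra rb.
  have S : v *m v^t* + v' *m v'^t* =
      (2 * (x * x^*)) *: (a *m a^t*) + (2 * (y * y^*)) *: (b *m b^t*).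
    rewrite -vE -vE' /X rmorphN /=.
    by apply/matrixP => i j; rewrite !mxE; ring.
  apply: (sum_outer_vanish S).
  by rewrite formD !formZ !form_kill // !mulr0 addr0.
(* every X x y is supported on the span of a and b, hence so are Z and Z' *)
have [P PE] : exists P : 'M_d, P = a *m e + b *m f by eexists.
have Pa : P *m a = a by rewrite PE mulmxDl -!mulmxA ea fa mulmx1 mulmx0 addr0.
have Pb : P *m b = b by rewrite PE mulmxDl -!mulmxA eb fb mulmx1 mulmx0 add0r.
have Pout (u w : 'cV_d) : P *m u = u -> P *m w = w -> P *m (u *m w^t*) *m P^t* = u *m w^t*.
  by move=> Pu Pw; rewrite mulmxA Pu -mulmxA -adjM Pw.
have PX x y : x * x^* + y * y^* = 1 -> P *m X x y *m P^t* = X x y.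
  move=> xy; have [p [q ->]] := XX _ _ xy; apply: Pout;
  by rewrite mulmxDr -!scalemxAr Pa Pb.
have Pcl : lin_closed (fun Y => P *m Y *m P^t* = Y).
  by move=> c u v Pu Pv; rewrite mulmxDr mulmxDl -scalemxAr -scalemxAl Pu Pv.
have PY x y : x * x^* + y * y^* = 1 ->
    P *m ((x * y^*) *: Z + (x^* * y) *: Z') *m P^t* = (x * y^*) *: Z + (x^* * y) *: Z'.
  move=> xy; have := PX _ _ xy; rewrite {1 2}/X mulmxDr mulmxDl.
  rewrite [P *m (_ *: (a *m _) + _)]mulmxDr mulmxDl -!scalemxAr -!scalemxAl.
  by rewrite !Pout // => /addrI.
have PZ : P *m Z *m P^t* = Z by apply: (cross_terms Pcl PY).
have PZ' : P *m Z' *m P^t* = Z'.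
  apply: (cross_terms (Z' := Z) Pcl) => x y xy.
  rewrite addrC mulrC [x * _]mulrC; apply: PY; by rewrite addrC.
have ZE : Z = form Z e e *: (a *m a^t*) + form Z f f *: (b *m b^t*) +
  (form Z e f *: (a *m b^t*) + form Z f e *: (b *m a^t*)).
  by rewrite -{1}PZ PE form_dec.
have ZE' : Z' = form Z' e e *: (a *m a^t*) + form Z' f f *: (b *m b^t*) +
  (form Z' e f *: (a *m b^t*) + form Z' f e *: (b *m a^t*)).
  by rewrite -{1}PZ' PE form_dec.
have HX x y : x * x^* + y * y^* = 1 -> (X x y)^t* = X x y.
  by move=> xy; have [p [q ->]] := XX _ _ xy; rewrite adjM trmxCK.
have ZZ' : Z^t* = Z'.
  have HY x y : x * x^* + y * y^* = 1 ->
      (x^* * y) *: (Z^t*) + (x * y^*) *: (Z'^t*) = (x * y^*) *: Z + (x^* * y) *: Z'.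
    move=> xy; have := HX _ _ xy; rewrite /X !(adjD, adjZ) !adjM !trmxCK.
    by rewrite !rmorphM /= !conjCK ![_^* * x]mulrC ![_^* * y]mulrC => /addrI.
  apply/eqP; rewrite eq_sym -subr_eq0; apply/eqP; rewrite -[LHS]trmxCK.
  suff -> : (Z' - Z^t*)^t* = 0 by rewrite adj0.
  rewrite adjB trmxCK; apply: (cross_terms (Z' := Z^t* - Z') (P := fun Y => Y = 0)).
    by move=> c u v -> ->; rewrite scaler0 addr0.
  move=> x y xy; have := HY _ _ xy; rewrite !scalerBr => E.
  by rewrite addrACA -opprD [X in X - _]addrC E subrr.
have [|al0 de0 bg bg1] := torus_det (al := form Z e e) (be := form Z e f)
  (ga := form Z f e) (de := form Z f f) (al' := form Z' e e) (be' := form Z' e f)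
  (ga' := form Z' f e) (de' := form Z' f f).
  move=> x y xy; have [p [q pq]] := XX _ _ xy.
  have := form_rank_one (p *: a + q *: b) e e f f; rewrite -pq /X.
  rewrite !(formD, formZ) !form_outer ea eb fa fb !mxE /=.
  by rewrite !conjC1 !conjC0 !(mulr0, mulr1, add0r, addr0) ![x^* * y * _]mulrC.
have e' : form Z' e f = (form Z f e)^* by rewrite -ZZ' form_adj.
have f' : form Z' f e = (form Z e f)^* by rewrite -ZZ' form_adj.
have ee' : form Z' e e = 0 by rewrite -ZZ' form_adj al0 conjC0.
have ff' : form Z' f f = 0 by rewrite -ZZ' form_adj de0 conjC0.
rewrite ee' ff' e' f' in ZE' bg1; rewrite al0 de0 in ZE.
move/eqP: bg; rewrite mulf_eq0 => /orP[] /eqP z0; rewrite z0 in ZE ZE' bg1.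
  exists (form Z f e); first by rewrite -bg1 conjC0 mulr0 add0r mulrC.
  by right; rewrite {1}ZE {1}ZE' conjC0 !scale0r !add0r addr0.
exists (form Z e f); first by rewrite -bg1 conjC0 mul0r addr0.
by left; rewrite {1}ZE {1}ZE' conjC0 !scale0r !add0r addr0.
Qed.

(** Let e, f be dual to g, h and D(r, s) = r D s^*.  If r annihilates g and h, then a minor of
    the pencil shows that D(r, r) (D(e, f) + z) is the same for all phases z, so D(r, r) = 0; hence
    the vectors v lie in the span of g and h.  Then |D(e, f) + z| is the same for all
    phases z, so D(e, f) = 0. *)
Lemma rank_one_pencil d (g h : 'cV[C]_d) (D : 'M_d) : indep g h ->
  (forall z, z * z^* = 1 -> exists v : 'cV_d,
     D + (z *: (g *m h^t*) + z^* *: (h *m g^t*)) = v *m v^t*) ->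
  exists x y, x * y^* = 1 /\
    D = (x * x^*) *: (g *m g^t*) + (y * y^*) *: (h *m h^t*).
Proof.
move=> gh H; have [e [f [eg eh fg fh]]] := indep_dual gh.
pose X z := D + (z *: (g *m h^t*) + z^* *: (h *m g^t*)).
have Dr (r : 'rV_d) : r *m g = 0 -> r *m h = 0 -> form D r r = 0.
  move=> rg rh.
  have E z : z * z^* = 1 -> form D r r * (form D e f + z) = form D r f * form D e r.
    move=> zz; have [v vE] := H z zz; have := form_rank_one v r r e f.
    rewrite -vE !(formD, formZ) !form_outer rg rh eg eh fg fh !mxE /=.
    by rewrite !conjC0 !conjC1 !(mul0r, mulr0, addr0, mulr1).
  have E1 := E 1; have E2 := E _ (phaseN1 C).
  have {}E1 := E1 (etrans (mul1r _) (conjC1 _)).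
  apply: (mulfI (_ : (2 : C) != 0)); first by rewrite pnatr_eq0.
  rewrite mulr0; transitivity (form D r r * (form D e f + 1) - form D r r * (form D e f + -1)).
    by ring.
  by rewrite E1 E2 subrr.
have XX z : z * z^* = 1 -> exists p q : C,
    X z = (p *: g + q *: h) *m (p *: g + q *: h)^t*.
  move=> zz; have [v vE] := H _ zz.
  exists ((e *m v) 0 0), ((f *m v) 0 0); rewrite /X vE -(span_of_annihilator eg eh fg fh) // => r rg rh.
  apply: form_vanish; rewrite -vE !(formD, formZ) !form_kill // Dr // !mulr0.
  by rewrite !addr0.
have Xform z : z * z^* = 1 ->
   (form D e f + z) * (form D f e + z^*) = form D e e * form D f f.
  move=> zz; have [v vE] := H z zz; have := form_rank_one v e e f f.
  rewrite -vE !(formD, formZ) !form_outer eg eh fg fh !mxE /=.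
  by rewrite !conjC0 !conjC1 !(mul0r, mulr0, addr0, mulr1, add0r) => ->.
have [p [q pq]] := XX 1 (etrans (mul1r _) (conjC1 _)).
have [k0 k0'] : form D e f = 0 /\ form D f e = 0.
  move: Xform; move: (form D e f) (form D f e) (_ * form D f f) => u w N E.
  have E1 := E 1 (etrans (mul1r _) (conjC1 _)).
  have E2 := E _ (phaseN1 C); have E3 := E _ (phasei C).
  have E4 : (u - 'i) * (w + 'i) = N.
    have := E (- 'i); rewrite rmorphN /= conjCi opprK; apply.
    by rewrite mulNr -expr2 sqrCi opprK.
  move: E1 E2 E3; rewrite rmorphN /= !conjC1 conjCi => E1 E2 E3.
  have two0 : (2 : C) != 0 by rewrite pnatr_eq0.
  have s0 : u + w = 0.
    apply: (mulfI two0); rewrite mulr0.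
    transitivity ((u + 1) * (w + 1) - (u + -1) * (w + -1)); first by ring.
    by rewrite E1 E2 subrr.
  have d0 : u - w = 0.
    apply: (mulfI (mulf_neq0 two0 (neq0Ci C))); rewrite mulr0.
    transitivity ((u - 'i) * (w + 'i) - (u + 'i) * (w - 'i)); first by ring.
    by rewrite E3 E4 subrr.
  split; apply: (mulfI two0); rewrite mulr0.
    by transitivity ((u + w) + (u - w)); [ring | rewrite s0 d0 addr0].
  by transitivity ((u + w) - (u - w)); [ring | rewrite s0 d0 subr0].
have fX r s : form (X 1) r s = form ((p *: g + q *: h) *m (p *: g + q *: h)^t*) r s.
  by rewrite pq.
have pq1 : p * q^* = 1.
  have := fX e f; rewrite /X outer2 !(formD, formZ) !form_outer eg eh fg fh !mxE /=.
  by rewrite k0 !(conjC0, conjC1, mul0r, mulr0, addr0, mulr1, add0r).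
have pq1' : p^* * q = 1 by rewrite -[q]conjCK -rmorphM pq1 rmorph1.
exists p, q; split=> //.
by move: pq; rewrite /X outer2 pq1 pq1' conjC1 => /addIr ->.
Qed.

End RankOne.

(** * Unital endomorphisms of the matrix algebra *)

Section InnerAutomorphism.
Variable C : numClosedFieldType.

(** Skolem-Noether in unitary form: F commutes with adjoints because it does on
    unitaries.  If w is a unit vector in the range of F(e e^* ), with e a
    basis vector, then x |-> F(x e^* ) w is an isometry that intertwines the identity
    representation with F. *)
Lemma unital_hom_inner m (F : 'M[C]_m -> 'M[C]_m) : (0 < m)%N -> linear F ->
  F 1%:M = 1%:M -> (forall A B, F (A *m B) = F A *m F B) ->
  (forall A, isometry A -> isometry (F A)) ->
  exists2 W : 'M_m, isometry W & forall A, F A = W *m A *m W^t*.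
Proof.
move=> m0 lF F1 FM Fiso; pose o : 'I_m := Ordinal m0.
have Fadj A : F (A^t*) = (F A)^t*.
  move: A; apply: (isometry_span (@iso1 C m)) => [a u v Fu Fv | U isoU].
    by rewrite adjD adjZ lF Fu Fv lF adjD adjZ.
  have VU : (F U)^t* *m F U = 1%:M by exact: Fiso.
  rewrite -[LHS]mulmx1 -(mulmx1C VU) mulmxA -FM (_ : _ *m U = 1%:M) //.
  by rewrite F1 mul1mx.
pose e : 'cV[C]_m := delta_mx o 0.
have eeT : e^t* *m e = 1%:M.
  rewrite /e -colE; apply/matrixP => i j; rewrite !ord1 !mxE eqxx.
  by rewrite conjC1.
have E0 : F (e *m e^t*) != 0.
  apply/eqP => FE0.
  have key (x y : 'cV[C]_m) : F (x *m y^t*) = 0.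
    have -> : x *m y^t* = (x *m e^t*) *m (e *m e^t*) *m (e *m y^t*).
      by rewrite !mulmxA -(mulmxA x) eeT mulmx1 -(mulmxA x) eeT mulmx1.
    by rewrite !FM FE0 mulmx0 mul0mx.
  have : F 1%:M = 0.
    have -> : 1%:M = \sum_(i < m) (delta_mx i 0 : 'cV[C]_m) *m (delta_mx i 0 : 'cV[C]_m)^t*.
      apply/matrixP => i j; rewrite summxE (bigD1 i) //= big1 => [|k ki].
        by rewrite !mxE big_ord1 !mxE !eqxx mul1r addr0 andbT conjC_nat eq_sym.
      by rewrite !mxE big_ord1 !mxE eq_sym (negPf ki) mul0r.
    by rewrite (big_morph F (fun u v => linD u v lF) (lin0 lF)) big1.
  rewrite F1 => /matrixP/(_ o o)/eqP; rewrite !mxE eqxx /= oner_eq0 //.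
have [j wj] : exists j, col j (F (e *m e^t*)) != 0.
  apply: contraNP E0 => /forallNP wj; apply/eqP/matrixP => i j.
  have /negP := wj j; rewrite negbK => /eqP/matrixP/(_ i 0).
  by rewrite !mxE.
set w := col j _ in wj.
have Pw : F (e *m e^t*) *m w = w.
  rewrite /w !colE mulmxA -FM; congr (F _ *m _).
  by rewrite mulmxA -(mulmxA e) eeT mulmx1.
set N := (w^t* *m w) 0 0.
have N0 : N != 0 by exact: gram_neq0.
pose r := (sqrtC N)^-1.
have rr : r^* * r * N = 1.
  rewrite /r fmorphV /= conj_Creal ?ger0_real ?sqrtC_ge0 ?adj_mul_ge0 //.
  by rewrite -invfM -expr2 sqrtCK mulVf.
pose L (x : 'cV[C]_m) := r *: (F (x *m e^t*) *m w).
have lL : linear L.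
  move=> a x y; rewrite /L mulmxDl -scalemxAl lF mulmxDl scalerDr -scalemxAl.
  by rewrite !scalerA mulrC.
have [W WL] := linear_matrix lL.
have isoW : isometry W.
  apply: eq_mul_col => y; rewrite mul1mx; apply/matrixP => i k; rewrite ord1.
  pose x : 'cV[C]_m := delta_mx i 0.
  have ent (A : 'cV[C]_m) : A i 0 = (x^t* *m A) 0 0.
    rewrite /x mxE (bigD1 i) //= big1 => [|l li].
      by rewrite !mxE !eqxx conjC1 mul1r addr0.
    by rewrite !mxE (negPf li) conjC0 mul0r.
  rewrite [LHS]ent [RHS]ent; have -> : x^t* *m (W^t* *m W *m y) = (L x)^t* *m L y.
    by rewrite !WL adjM !mulmxA.
  rewrite /L adjZ adjM -Fadj -scalemxAl -scalemxAr scalerA.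
  rewrite !mulmxA -(mulmxA _ (F _) (F _)) -FM.
  have -> : (x *m e^t*)^t* *m (y *m e^t*) = (x^t* *m y) 0 0 *: (e *m e^t*).
    by rewrite adjM trmxCK mulmxA -(mulmxA e) mulmx_scalar1.
  rewrite (linZ _ _ lF) -scalemxAr -scalemxAl -mulmxA Pw scalerA mxE -/N.
  by rewrite mulrAC rr mul1r.
exists W => // A; rewrite -[LHS]mulmx1 -(mulmx1C isoW) mulmxA; congr (_ *m _).
apply: eq_mul_col => x; rewrite -!mulmxA -!WL /L -scalemxAr mulmxA -FM.
by rewrite mulmxA.
Qed.

End InnerAutomorphism.

(** * Vectors as matrices *)

Section Vectorisation.
Variable C : numClosedFieldType.

Definition vec m n (A : 'M[C]_(n, m)) : 'cV[C]_(m * n) :=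
  \col_s A (mxtens_unindex s).2 (mxtens_unindex s).1.

Definition mat m n (u : 'cV[C]_(m * n)) : 'M[C]_(n, m) :=
  \matrix_(i, j) u (mxtens_index (j, i)) 0.

Lemma vecK m n : cancel (@vec m n) (@mat m n).
Proof. by move=> A; apply/matrixP => i j; rewrite !mxE mxtens_indexK. Qed.

Lemma matK m n : cancel (@mat m n) (@vec m n).
Proof.
by move=> u; apply/matrixP => i j; rewrite !mxE -surjective_pairing mxtens_unindexK ord1.
Qed.

Lemma vec_linear m n : linear (@vec m n).
Proof. by move=> a A B; apply/matrixP => i j; rewrite !mxE. Qed.

Lemma mat_linear m n : linear (@mat m n).
Proof. by move=> a A B; apply/matrixP => i j; rewrite !mxE. Qed.

Lemma vec_mul m n (U : 'M[C]_m) (V : 'M[C]_n) (A : 'M[C]_(n, m)) :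
  tensmx U V *m vec A = vec (V *m A *m U^T).
Proof.
apply/matrixP => s j; rewrite !mxE.
under [RHS]eq_bigr => k _ do rewrite !mxE big_distrl /=.
rewrite pair_big /= (reindex (@mxtens_index m n)) /=; last first.
  by exists (@mxtens_unindex m n) => ? _; rewrite ?mxtens_indexK ?mxtens_unindexK.
by apply: eq_bigr => -[k l] _; rewrite !mxE !mxtens_indexK /=; ring.
Qed.

Lemma tensmx_outer m n (x : 'cV[C]_m) (y : 'cV[C]_n) :
  (tensmx x y : 'cV_(m * n)) = vec (y *m x^T).
Proof.
apply/matrixP => s j; rewrite !mxE big_ord1 !mxE mulrC.
by congr (y _ _ * x _ _); rewrite [LHS]ord1.
Qed.

Lemma vec0 m n : vec (0 : 'M[C]_(n, m)) = 0.
Proof. exact: lin0 (@vec_linear m n). Qed.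

Lemma vec_inj m n : injective (@vec m n).
Proof. exact: can_inj (@vecK m n). Qed.

Lemma vec_eq0 n m (A : 'M[C]_(n, m)) : (vec A == 0) = (A == 0).
Proof. by rewrite -(vec0 m n) (inj_eq (@vec_inj m n)). Qed.

Definition dyad m n (A B : 'M[C]_(n, m)) : 'M[C]_(m * n) := vec A *m (vec B)^t*.

Lemma dyad_linl m n (B : 'M[C]_(n, m)) a A A' :
  dyad (a *: A + A') B = a *: dyad A B + dyad A' B.
Proof. by rewrite /dyad vec_linear mulmxDl scalemxAl. Qed.

Lemma dyad_linr m n (A : 'M[C]_(n, m)) a B B' :
  dyad A (a *: B + B') = a^* *: dyad A B + dyad A B'.
Proof. by rewrite /dyad vec_linear adjD adjZ mulmxDr scalemxAr. Qed.

Lemma dyad_sum m n (A B : 'M[C]_(n, m)) x y :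
  dyad (x *: A + y *: B) (x *: A + y *: B) =
  (x * x^*) *: dyad A A + (y * y^*) *: dyad B B +
  ((x * y^*) *: dyad A B + (x^* * y) *: dyad B A).
Proof.
by rewrite /dyad (linD _ _ (@vec_linear m n)) !(linZ _ _ (@vec_linear m n)) outer2.
Qed.

Lemma dyad_tr m n (A : 'M[C]_(n, m)) :
  (dyad A A)^T = dyad (map_mx Num.conj A) (map_mx Num.conj A).
Proof.
rewrite /dyad trmx_mul; congr (_ *m _).
  by apply/matrixP => i j; rewrite !mxE.
by apply/matrixP => i j; rewrite !mxE conjCK.
Qed.

Lemma iso_dyad n m (A B : 'M[C]_(n, m)) :
  isometry B -> dyad A A = dyad B B -> isometry A.
Proof.
move=> isoB /outer_phase[z zz].
by rewrite -(linZ _ _ (@vec_linear m n)) => /vec_inj ->; apply: iso_phase.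
Qed.

Definition iso_dyads m n : set 'M[C]_(m * n) :=
  [set X | exists2 A : 'M[C]_(n, m), isometry A & X = dyad A A].

Lemma lspan_iso_dyad m n (A : 'M[C]_(n, m)) :
  isometry A -> lspan (@iso_dyads m n) (dyad A A).
Proof. by move=> isoA; apply: lspan_gen; exists A. Qed.

Lemma lspan_cross m n (A B : 'M[C]_(n, m)) : isometry A -> isometry B ->
  A^t* *m B = 0 -> lspan (@iso_dyads m n) (dyad A B).
Proof.
move=> isoA isoB AB; apply: (cross_terms (@lspan_closed _ _ _) (Z' := dyad B A)) => x y xy.
have := lspan_iso_dyad (iso_comb isoA isoB AB xy); rewrite dyad_sum => SX.
rewrite -[X in lspan _ X](addKr ((x * x^*) *: dyad A A + (y * y^*) *: dyad B B)).
rewrite -scaleN1r; apply: lspan_closed => //; apply: lspan_closed; first exact: lspan_iso_dyad.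
by apply: lin_closedZ; [exact: lspan_closed | apply: lspan_iso_dyad].
Qed.

End Vectorisation.

(** * Preservers and isometries with orthogonal ranges *)

Record iso_preserver (C : numClosedFieldType) (m n : nat)
    (Phi : {linear 'M[C]_(m * n) -> 'M[C]_(m * n)}) : Prop := IsoPreserver {
  iso_preserver_inj : forall X, lspan (@iso_dyads C m n) X -> Phi X = 0 -> X = 0;
  iso_preserver_image : forall A : 'M[C]_(n, m), isometry A ->
    exists2 B : 'M[C]_(n, m), isometry B & Phi (dyad A A) = dyad B B }.

Section Preserver.
Variables (C : numClosedFieldType) (m n : nat).
Variable Phi : {linear 'M[C]_(m * n) -> 'M[C]_(m * n)}.
Hypothesis m_gt0 : (0 < m)%N.
Hypothesis PhiP : iso_preserver Phi.
Let S (A B : 'M[C]_(n, m)) := Phi (dyad A B).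

Lemma Phi_separates (A B : 'M[C]_(n, m)) c : isometry A -> isometry B ->
  A^t* *m B = 0 -> S A A <> c *: S B B.
Proof.
move=> isoA isoB AB E.
have : lspan (@iso_dyads C m n) (- c *: dyad B B + dyad A A).
  by apply: lspan_closed; apply: lspan_iso_dyad.
move/(iso_preserver_inj PhiP); rewrite linearP /= -/(S A A) -/(S B B) E scaleNr addNr => /(_ erefl).
rewrite addrC scaleNr => /eqP; rewrite subr_eq0 => /eqP {}E.
have A0 : vec A != 0 by rewrite (vec_eq0 A) (iso_neq0 m_gt0 isoA).
have [z zE] : exists z, vec A = z *: (c *: vec B).
  by apply: (outer_par (w := vec A) (k := vec B)) => //; rewrite -scalemxAl; exact: E.
move: zE; rewrite scalerA -(linZ _ _ (@vec_linear C m n)) => /vec_inj AE.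
by move: (iso_neq0 m_gt0 (@iso1 C m)); rewrite -isoA {2}AE -scalemxAr AB scaler0 eqxx.
Qed.

(** The unit sphere of the span of A and B consists of isometries, so Phi preserves the pure
    states of this qubit; a and b are independent by injectivity. *)
Lemma Phi_cross (A B : 'M[C]_(n, m)) (a b : 'cV_(m * n)) :
  isometry A -> isometry B -> A^t* *m B = 0 ->
  S A A = a *m a^t* -> S B B = b *m b^t* ->
  indep a b /\ exists2 l, l * l^* = 1 &
    S A B = l *: (a *m b^t*) /\ S B A = l^* *: (b *m a^t*) \/
    S A B = l *: (b *m a^t*) /\ S B A = l^* *: (a *m b^t*).
Proof.
move=> isoA isoB AB SA SB; have BA : B^t* *m A = 0.
  by rewrite -[LHS]trmxCK adjM trmxCK AB adj0.
have ab : indep a b.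
  by apply: indep_outer => c; rewrite -SA -SB; apply: Phi_separates.
split=> //; apply: qubit_preserver => // x y xy.
have [D _ DE] := iso_preserver_image PhiP (iso_comb isoA isoB AB xy).
exists (vec D); rewrite -/(dyad D D) -DE dyad_sum.
by rewrite !(linearD, linearZ) /= -/(S A A) -/(S B B) SA SB.
Qed.

(** Up to a phase, the image of x A + y B is x' A' + y' B' with |x'| = |x| and |y'| = |y|.
    As this is an isometry whatever the phases, the cross terms A'^* B' vanish. *)
Lemma Phi_orth (A B A' B' : 'M[C]_(n, m)) :
  isometry A -> isometry B -> A^t* *m B = 0 ->
  isometry A' -> isometry B' -> S A A = dyad A' A' -> S B B = dyad B' B' ->
  A'^t* *m B' = 0.
Proof.
move=> isoA isoB AB isoA' isoB' SA SB.
have [_ [l ll cross]] := Phi_cross isoA isoB AB SA SB.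
have phase x y : x * x^* + y * y^* = 1 -> isometry (x *: A' + y *: B') ->
    (x * y^*) *: (B'^t* *m A') + (x^* * y) *: (A'^t* *m B') = 0.
  move=> xy; rewrite /isometry adjD !adjZ mulmxDl !mulmxDr -!scalemxAl -!scalemxAr.
  rewrite isoA' isoB' !scalerA => E; apply: (addrI 1%:M).
  have F : (x * x^*) *: 1%:M + (y * y^*) *: 1%:M = 1%:M :> 'M[C]_m.
    by rewrite -scalerDl xy scale1r.
  rewrite addr0 -[RHS]E -{1}F.
  by apply/matrixP => i j; rewrite !mxE; ring.
have SX x y : x * x^* + y * y^* = 1 -> exists2 D : 'M_(n, m), isometry D &
    (x * x^*) *: dyad A' A' + (y * y^*) *: dyad B' B' +
    ((x * y^*) *: S A B + (x^* * y) *: S B A) = dyad D D.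
  move=> xy; have [D isoD DE] := iso_preserver_image PhiP (iso_comb isoA isoB AB xy).
  by exists D => //; rewrite -DE dyad_sum !(linearD, linearZ) /= -SA -SB.
have lc : l^* * l = 1 by rewrite mulrC.
have BA0 : l *: (B'^t* *m A') = 0 \/ l *: (A'^t* *m B') = 0.
  case: cross => -[SAB SBA]; [left|right].
    apply: (cross_terms (Z' := l^* *: (A'^t* *m B')) (P := fun X => X = 0)).
      by move=> a u v -> ->; rewrite scaler0 addr0.
    move=> x y xy; have [D isoD DE] := SX _ _ xy.
    have xy' : x * x^* + (y * l^*) * (y * l^*)^* = 1.
      by rewrite rmorphM /= conjCK mulrACA lc mulr1.
    have := phase _ _ xy'; rewrite rmorphM /= conjCK !scalerA !mulrA; apply.
    apply: (iso_dyad isoD); rewrite -DE dyad_sum SAB SBA !scalerA.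
    by rewrite rmorphM /= conjCK mulrACA lc mulr1 !mulrA.
  apply: (cross_terms (Z' := l^* *: (B'^t* *m A')) (P := fun X => X = 0)).
    by move=> a u v -> ->; rewrite scaler0 addr0.
  move=> x y xy; have [D isoD DE] := SX _ _ xy.
  have xy' : x^* * x^*^* + (y^* * l) * (y^* * l)^* = 1.
    by rewrite rmorphM /= !conjCK mulrACA ll mulr1 ![_^* * _]mulrC.
  rewrite addrC; have := phase _ _ xy'; rewrite rmorphM /= !conjCK !scalerA !mulrA; apply.
  apply: (iso_dyad isoD); rewrite -DE dyad_sum SAB SBA !scalerA.
  rewrite rmorphM /= !conjCK mulrACA ll mulr1 !mulrA ![_^* * x]mulrC ![_^* * y]mulrC.
  by rewrite [X in _ + X]addrC.
have l0 : l != 0 by apply/eqP => l0; move/eqP: ll; rewrite l0 mul0r eq_sym oner_eq0.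
case: BA0 => /eqP; rewrite scaler_eq0 (negPf l0) /= => /eqP // BA0.
by rewrite -[LHS]trmxCK adjM trmxCK BA0 adj0.
Qed.

End Preserver.

(** * The linear map behind a preserver *)

Section Blocks.
Variables (C : numClosedFieldType) (m p : nat).
Local Notation n := (m + p)%N.

Definition up (M : 'M[C]_m) : 'M[C]_(m + p, m) := col_mx M 0.
Definition dn (N : 'M[C]_(p, m)) : 'M[C]_(m + p, m) := col_mx 0 N.

Lemma up_linear : linear up.
Proof. by move=> a A B; rewrite /up scale_col_mx add_col_mx scaler0 addr0. Qed.

Lemma dn_linear : linear dn.
Proof. by move=> a A B; rewrite /dn scale_col_mx add_col_mx scaler0 addr0. Qed.

Lemma adj_col_mx (A A' : 'M[C]_m) (B B' : 'M[C]_(p, m)) :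
  (col_mx A B)^t* *m col_mx A' B' = A^t* *m A' + B^t* *m B'.
Proof. by rewrite tr_col_mx map_row_mx mul_row_col. Qed.

Lemma up_dn_orth M N : (up M)^t* *m dn N = 0.
Proof. by rewrite adj_col_mx mulmx0 trmx0 map_mx0 mul0mx addr0. Qed.

Lemma iso_up M : isometry M -> isometry (up M).
Proof. by rewrite /isometry adj_col_mx mulmx0 addr0. Qed.

Lemma iso_dn N : isometry N -> isometry (dn N).
Proof. by rewrite /isometry adj_col_mx mulmx0 add0r. Qed.

Lemma outer_col_closed d (a : 'cV[C]_d) :
  lin_closed (fun X : 'M_d => exists k : 'cV_d, X = a *m k^t*).
Proof.
move=> c _ _ [k ->] [k' ->]; exists (c^* *: k + k').
by rewrite adjD adjZ conjCK mulmxDr -scalemxAr.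
Qed.

Lemma outer_row_closed d (a : 'cV[C]_d) :
  lin_closed (fun X : 'M_d => exists k : 'cV_d, X = k *m a^t*).
Proof.
by move=> c _ _ [k ->] [k' ->]; exists (c *: k + k'); rewrite mulmxDl -scalemxAl.
Qed.

Lemma closed_conj (V W : lmodType C) (f : V -> W) (P : W -> Prop) :
  (forall a u v, f (a *: u + v) = a^* *: f u + f v) -> lin_closed P ->
  lin_closed (fun v => P (f v)).
Proof. by move=> fl cP a u v Pu Pv; rewrite fl; apply: cP. Qed.

Lemma closed_lin (V W : lmodType C) (f : V -> W) (P : W -> Prop) :
  (forall a u v, f (a *: u + v) = a *: f u + f v) -> lin_closed P ->
  lin_closed (fun v => P (f v)).
Proof. by move=> fl cP a u v Pu Pv; rewrite fl; apply: cP. Qed.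

Variable Phi : {linear 'M[C]_(m * n) -> 'M[C]_(m * n)}.
Hypothesis m_gt0 : (0 < m)%N.
Hypothesis PhiP : iso_preserver Phi.
Variable J : 'M[C]_(p, m).
Hypothesis isoJ : isometry J.
Let S (A B : 'M[C]_(n, m)) := Phi (dyad A B).
Let T M N := S (up M) (dn N).

Lemma T_linl N a M M' : T (a *: M + M') N = a *: T M N + T M' N.
Proof. by rewrite /T /S up_linear dyad_linl linearP. Qed.

Lemma T_linr M a N N' : T M (a *: N + N') = a^* *: T M N + T M N'.
Proof. by rewrite /T /S dn_linear dyad_linr linearP. Qed.

Lemma T_cross U1 U2 (a b : 'cV_(m * n)) : isometry U1 -> isometry U2 ->
  S (up U1) (up U1) = a *m a^t* -> S (dn U2) (dn U2) = b *m b^t* ->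
  indep a b /\ exists2 l, l * l^* = 1 &
    T U1 U2 = l *: (a *m b^t*) /\ S (dn U2) (up U1) = l^* *: (b *m a^t*) \/
    T U1 U2 = l *: (b *m a^t*) /\ S (dn U2) (up U1) = l^* *: (a *m b^t*).
Proof.
move=> iso1 iso2; apply: (Phi_cross m_gt0 PhiP).
- exact: iso_up.
- exact: iso_dn.
- exact: up_dn_orth.
Qed.

Lemma up_image U : isometry U -> exists a : 'cV_(m * n), S (up U) (up U) = a *m a^t*.
Proof. by move=> /iso_up/(iso_preserver_image PhiP)[B _ E]; exists (vec B). Qed.

Lemma dn_image U : isometry U -> exists a : 'cV_(m * n), S (dn U) (dn U) = a *m a^t*.
Proof. by move=> /iso_dn/(iso_preserver_image PhiP)[B _ E]; exists (vec B). Qed.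

(** On isometries N one of the two forms holds, and each form defines a subspace. *)
Lemma left_or_right U (a : 'cV_(m * n)) : isometry U -> S (up U) (up U) = a *m a^t* ->
  (forall N, exists k : 'cV_(m * n), T U N = a *m k^t*) \/
  (forall N, exists k : 'cV_(m * n), T U N = k *m a^t*).
Proof.
move=> isoU Sa; apply: (isometry_cover isoJ).
- exact: closed_conj (T_linr U) (@outer_col_closed _ a).
- exact: closed_conj (T_linr U) (@outer_row_closed _ a).
move=> N isoN; have [b Sb] := dn_image isoN.
have [_ [l _ [] [-> _]]] := T_cross isoU isoN Sa Sb; [left|right].
  by exists (l^* *: b); rewrite adjZ conjCK -scalemxAr.
by exists (l *: b); rewrite -scalemxAl.
Qed.

Section LeftType.
Variable a : 'cV[C]_(m * n).
Hypothesis Sa : S (up 1%:M) (up 1%:M) = a *m a^t*.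
Hypothesis left_type : forall N, exists k : 'cV_(m * n), T 1%:M N = a *m k^t*.

(** If instead all T M U2 were of the form b k^*, then T 1 U2 would have a range spanned
    both by a and by b, which are independent. *)
Lemma left_type_dn U2 (b : 'cV_(m * n)) : isometry U2 -> S (dn U2) (dn U2) = b *m b^t* ->
  forall M, exists k : 'cV_(m * n), T M U2 = k *m b^t*.
Proof.
move=> iso2 Sb; have [ab [l ll H1]] := T_cross (@iso1 C m) iso2 Sa Sb.
have cl1 := closed_lin (T_linl U2) (@outer_row_closed _ b).
have cl2 := closed_lin (T_linl U2) (@outer_col_closed _ b).
have := isometry_cover (@iso1 C m) cl1 cl2.
case=> // [U1 iso_1|right2].
  have [a1 Sa1] := up_image iso_1.
  have [_ [l1 _ [] [-> _]]] := T_cross iso_1 iso2 Sa1 Sb; [left|right].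
    by exists (l1 *: a1); rewrite -scalemxAl.
  by exists (l1^* *: a1); rewrite adjZ conjCK -scalemxAr.
have [k kE] := left_type U2; have [k' k'E] := right2 1%:M.
have l0 := phase_neq0 ll; case: H1 => -[E _].
  have [c aE] : exists c, l *: a = c *: b.
    apply: (outer_par (w := b) (k := k')); last exact: indep_neq0 (indep_sym ab).
    by rewrite -scalemxAl -E k'E.
  by case: (indep_not_par ab l0 aE).
have [c bE] : exists c, l *: b = c *: a.
  apply: (outer_par (w := a) (k := k)); last exact: indep_neq0 ab.
  by rewrite -scalemxAl -E kE.
by case: (indep_not_par (indep_sym ab) l0 bE).
Qed.

Lemma left_type_all U1 U2 (a1 b : 'cV_(m * n)) : isometry U1 -> isometry U2 ->
  S (up U1) (up U1) = a1 *m a1^t* -> S (dn U2) (dn U2) = b *m b^t* ->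
  exists2 l, l * l^* = 1 &
    T U1 U2 = l *: (a1 *m b^t*) /\ S (dn U2) (up U1) = l^* *: (b *m a1^t*).
Proof.
move=> iso_1 iso2 Sa1 Sb; have [ab [l ll H1]] := T_cross iso_1 iso2 Sa1 Sb.
exists l => //; case: H1 => // -[E _].
have [k kE] := left_type_dn iso2 Sb U1.
have b0 := indep_neq0 (indep_sym ab).
have [c aE] : exists c, l^* *: a1 = c *: b.
  apply: (outer_par (w := b) (k := k)) => //.
  by rewrite -scalemxAl -[LHS]trmxCK adjZ adjM trmxCK conjCK -E kE adjM trmxCK.
have l0 : l^* != 0 by rewrite conjC_eq0 phase_neq0.
by case: (indep_not_par ab l0 aE).
Qed.

(** G and K are read off from the values T M J and T 1 N.  Then T U1 U2 = l G(U1) K(U2)^*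
    with a phase l; for fixed U1 the map N |-> (T U1 N)^* G(U1) is proportional to K on
    isometries, hence a multiple of K, and the value at J shows that l = 1. *)
Lemma left_type_factor : exists (G : 'M[C]_m -> 'cV[C]_(m * n))
    (K : 'M[C]_(p, m) -> 'cV[C]_(m * n)),
  [/\ linear G, linear K,
     (forall M N, T M N = G M *m (K N)^t*) /\
     (forall M N, S (dn N) (up M) = K N *m (G M)^t*),
     forall U, isometry U -> S (up U) (up U) = G U *m (G U)^t* &
     forall U, isometry U -> S (dn U) (dn U) = K U *m (K U)^t*].
Proof.
have a0 : a != 0.
  have [b Sb] := dn_image isoJ.
  by have [ab _] := T_cross (@iso1 C m) isoJ Sa Sb; apply: indep_neq0 ab.
pose na := (a^t* *m a) 0 0; have na0 : na != 0 by exact: gram_neq0.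
pose K N := na^-1 *: ((T 1%:M N)^t* *m a).
have lK : linear K.
  move=> c u v; rewrite /K T_linr adjD adjZ conjCK mulmxDl -scalemxAl scalerDr.
  by rewrite !scalerA [_ * c]mulrC.
have TK N : T 1%:M N = a *m (K N)^t*.
  have [k kE] := left_type N; rewrite kE /K kE adjM trmxCK -mulmxA.
  by rewrite (mx11_scalar (a^t* *m a)) mul_mx_scalar scalerK.
have Sd U : isometry U -> S (dn U) (dn U) = K U *m (K U)^t*.
  move=> isoU; have [b Sb] := dn_image isoU.
  have [l ll [E _]] := left_type_all (@iso1 C m) isoU Sa Sb.
  have -> : K U = l^* *: b.
    rewrite /K E adjZ adjM trmxCK -scalemxAl -mulmxA (mx11_scalar (a^t* *m a)).
    by rewrite mul_mx_scalar scalerA mulrC -scalerA scalerK.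
  by rewrite adjZ conjCK -scalemxAl -scalemxAr scalerA mulrC ll scale1r.
pose d := K J; have Sdd : S (dn J) (dn J) = d *m d^t* by exact: Sd.
have d0 : d != 0.
  have [ad _] := T_cross (@iso1 C m) isoJ Sa Sdd.
  exact: indep_neq0 (indep_sym ad).
pose nd := (d^t* *m d) 0 0; have nd0 : nd != 0 by exact: gram_neq0.
pose G M := nd^-1 *: (T M J *m d).
have lG : linear G.
  move=> c u v; rewrite /G T_linl mulmxDl -scalemxAl scalerDr.
  by rewrite !scalerA [_ * c]mulrC.
have TG M : T M J = G M *m d^t*.
  have [k kE] := left_type_dn isoJ Sdd M; rewrite kE /G kE -mulmxA.
  by rewrite (mx11_scalar (d^t* *m d)) mul_mx_scalar scalerK.
have Su U : isometry U -> S (up U) (up U) = G U *m (G U)^t*.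
  move=> isoU; have [b Sb] := up_image isoU.
  have [l ll [E _]] := left_type_all isoU isoJ Sb Sdd.
  have -> : G U = l *: b.
    rewrite /G E -scalemxAl -mulmxA (mx11_scalar (d^t* *m d)).
    by rewrite mul_mx_scalar scalerA mulrC -scalerA scalerK.
  by rewrite adjZ -scalemxAl -scalemxAr scalerA ll scale1r.
have Kinj N : K N = 0 -> N = 0.
  move=> K0; have : dyad (up 1%:M) (dn N) = 0.
    apply: (iso_preserver_inj PhiP); last by rewrite -[LHS]/(T 1%:M N) TK K0 adj0 mulmx0.
    move: N {K0}; apply: (isometry_span isoJ) => [|N isoN].
      apply: (closed_conj (f := fun N => dyad (up 1%:M) (dn N)) _ (@lspan_closed _ _ _)).
      by move=> c u v; rewrite dn_linear dyad_linr.
    apply: (@lspan_cross C m n); [exact/iso_up/iso1 | exact: iso_dn | exact: up_dn_orth].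
  move=> /outer_eq0; rewrite vec_eq0 (iso_neq0 m_gt0 (iso_up (@iso1 C m))) => /(_ erefl).
  by move/eqP; rewrite vec_eq0 col_mx_eq0 eqxx => /eqP.
have main U1 U2 : isometry U1 -> isometry U2 ->
    T U1 U2 = G U1 *m (K U2)^t* /\ S (dn U2) (up U1) = K U2 *m (G U1)^t*.
  move=> iso_1 iso_2; pose g := G U1.
  have [l ll [E E']] := left_type_all iso_1 iso_2 (Su _ iso_1) (Sd _ iso_2).
  suff l1 : l = 1 by move: E E'; rewrite l1 conjC1 !scale1r.
  pose ng := (g^t* *m g) 0 0.
  have ng0 : ng != 0.
    apply: gram_neq0; have [gd _] := T_cross iso_1 isoJ (Su _ iso_1) Sdd.
    exact: indep_neq0 gd.
  pose h N := (T U1 N)^t* *m g.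
  have hE U (x : C) : T U1 U = x *: (g *m (K U)^t*) -> h U = (x^* * ng) *: K U.
    move=> E0; rewrite /h E0 adjZ adjM trmxCK -scalemxAl -mulmxA (mx11_scalar (g^t* *m g)).
    by rewrite mul_mx_scalar scalerA.
  have [c hc] : exists c, forall N, h N = c *: K N.
    apply: (isometry_eigen isoJ) => // [x u v|U isoU].
      by rewrite /h T_linr adjD adjZ conjCK mulmxDl -scalemxAl.
    have [x _ [E0 _]] := left_type_all iso_1 isoU (Su _ iso_1) (Sd _ isoU).
    by exists (x^* * ng); apply: hE.
  have K0 U : isometry U -> K U != 0.
    move=> isoU; apply/eqP => /Kinj U0; move: (iso_neq0 m_gt0 isoU).
    by rewrite U0 eqxx.
  have cE U x : isometry U -> h U = x *: K U -> c = x.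
    move=> isoU; rewrite hc => /eqP; rewrite -subr_eq0 -scalerBl scaler_eq0.
    by rewrite (negPf (K0 _ isoU)) orbF subr_eq0 => /eqP.
  have c1 : c = ng.
    have hJ : h J = (1^* * ng) *: K J by apply: hE; rewrite TG scale1r.
    by apply: (cE J ng isoJ); rewrite hJ conjC1 mul1r.
  have := cE _ _ iso_2 (hE _ _ E); rewrite c1 -[LHS]mul1r => /(mulIf ng0) l1.
  by rewrite -[l]conjCK -l1 conjC1.
clearbody G K; exists G, K; split=> //; split=> M N.
  move: N; apply: (isometry_span isoJ) => [c u v Eu Ev | U2 iso2].
    by rewrite T_linr Eu Ev lK adjD adjZ mulmxDr scalemxAr.
  move: M; apply: (isometry_span (@iso1 C m)) => [c u v Eu Ev | U1 iso_1].
    by rewrite T_linl Eu Ev lG mulmxDl scalemxAl.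
  by have [] := main _ _ iso_1 iso2.
move: N; apply: (isometry_span isoJ) => [c u v Eu Ev | U2 iso2].
  by rewrite /S dn_linear dyad_linl linearP -!/(S _ _) Eu Ev lK mulmxDl scalemxAl.
move: M; apply: (isometry_span (@iso1 C m)) => [c u v Eu Ev | U1 iso_1].
  by rewrite /S up_linear dyad_linr linearP -!/(S _ _) Eu Ev lG adjD adjZ mulmxDr scalemxAr.
by have [] := main _ _ iso_1 iso2.
Qed.

Lemma left_type_gamma : exists Gam : 'M[C]_(n, m) -> 'M[C]_(n, m),
  [/\ linear Gam,
     forall M N, S (up M) (dn N) = dyad (Gam (up M)) (Gam (dn N)),
     forall M N, S (dn N) (up M) = dyad (Gam (dn N)) (Gam (up M)),
     forall U, isometry U -> S (up U) (up U) = dyad (Gam (up U)) (Gam (up U)) &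
     forall U, isometry U -> S (dn U) (dn U) = dyad (Gam (dn U)) (Gam (dn U))].
Proof.
have [G [K [lG lK [GK KG] GG KK]]] := left_type_factor.
exists (fun A => mat (G (usubmx A) + K (dsubmx A))).
have Gu M : mat (G (usubmx (up M)) + K (dsubmx (up M))) = mat (G M).
  by rewrite col_mxKu col_mxKd (lin0 lK) addr0.
have Gd N : mat (G (usubmx (dn N)) + K (dsubmx (dn N))) = mat (K N).
  by rewrite col_mxKu col_mxKd (lin0 lG) add0r.
split=> [c A B|M N|M N|U isoU|U isoU].
- rewrite !linearP lG lK -(@mat_linear C m n); congr mat.
  by rewrite scalerDr addrACA.
- by rewrite Gu Gd /dyad !matK; apply: GK.
- by rewrite Gu Gd /dyad !matK; apply: KG.
- by rewrite Gu /dyad !matK; apply: GG.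
- by rewrite Gd /dyad !matK; apply: KK.
Qed.

End LeftType.
End Blocks.

(** * The linear map is a two-sided multiplication *)

Section Gamma.
Variables (C : numClosedFieldType) (m p k : nat).
Local Notation n := (m + p)%N.
Variable Phi : {linear 'M[C]_(m * n) -> 'M[C]_(m * n)}.
Hypothesis m_gt0 : (0 < m)%N.
Hypothesis PhiP : iso_preserver Phi.
Let S (A B : 'M[C]_(n, m)) := Phi (dyad A B).

Hypothesis pkm : p = (k * m)%N.
Variable B : 'I_k -> 'M[C]_(p, m).
Variable o : 'I_k.
Hypothesis isoB : forall i, isometry (B i).
Hypothesis orthB : forall i j, i != j -> (B i)^t* *m B j = 0.

Variable Gam : 'M[C]_(n, m) -> 'M[C]_(n, m).
Hypothesis Gam_linear : linear Gam.
Hypothesis Gam_ud : forall M N, S (up p M) (dn N) = dyad (Gam (up p M)) (Gam (dn N)).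
Hypothesis Gam_du : forall M N, S (dn N) (up p M) = dyad (Gam (dn N)) (Gam (up p M)).
Hypothesis Gam_uu : forall U, isometry U ->
  S (up p U) (up p U) = dyad (Gam (up p U)) (Gam (up p U)).
Hypothesis Gam_dd : forall U, isometry U ->
  S (dn U) (dn U) = dyad (Gam (dn U)) (Gam (dn U)).

Lemma Gam_iso A : isometry A -> S A A = dyad (Gam A) (Gam A) -> isometry (Gam A).
Proof. by move=> /(iso_preserver_image PhiP)[D isoD SD] SG; apply: (iso_dyad isoD); rewrite -SG. Qed.

Lemma Gam_orth A A' : isometry A -> isometry A' -> A^t* *m A' = 0 ->
  S A A = dyad (Gam A) (Gam A) -> S A' A' = dyad (Gam A') (Gam A') ->
  (Gam A)^t* *m Gam A' = 0.
Proof.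
move=> isoA isoA' AA' SA SA'.
apply: (Phi_orth m_gt0 PhiP isoA isoA') => //; exact: Gam_iso.
Qed.

Lemma Gam_comb U1 U2 x y : isometry U1 -> isometry U2 ->
  S (x *: up p U1 + y *: dn U2) (x *: up p U1 + y *: dn U2) =
  dyad (Gam (x *: up p U1 + y *: dn U2)) (Gam (x *: up p U1 + y *: dn U2)).
Proof.
move=> iso_1 iso_2; rewrite (linD _ _ Gam_linear) !(linZ _ _ Gam_linear) dyad_sum /S dyad_sum.
by rewrite !(linearD, linearZ) /= -!/(S _ _) Gam_uu // Gam_dd // Gam_ud Gam_du.
Qed.

Lemma Gam_orth_ud M N : (Gam (up p M))^t* *m Gam (dn N) = 0.
Proof.
move: N; apply: (isometry_span (isoB o)) => [c u v Eu Ev | U2 iso2].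
  by rewrite dn_linear Gam_linear mulmxDr -scalemxAr Eu Ev scaler0 addr0.
move: M; apply: (isometry_span (@iso1 C m)) => [c u v Eu Ev | U1 iso_1].
  by rewrite up_linear Gam_linear adjD adjZ mulmxDl -scalemxAl Eu Ev scaler0 addr0.
by apply: Gam_orth; [exact: iso_up | exact: iso_dn | exact: up_dn_orth | exact: Gam_uu | exact: Gam_dd].
Qed.

Lemma Gam_orth_du M N : (Gam (dn N))^t* *m Gam (up p M) = 0.
Proof. by rewrite -[LHS]trmxCK adjM trmxCK Gam_orth_ud adj0. Qed.

Let gram (T : 'M[C]_m) := (Gam (up p 1%:M))^t* *m Gam (up p T).

(** The isometries c U1 + s U2 and s U1 T - c U2 T have orthogonal ranges when T is unitary,
    hence so do their images. *)
Lemma Gram_transport U1 U2 T : isometry U1 -> isometry U2 ->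
  (Gam (up p U1))^t* *m Gam (up p (U1 *m T)) = (Gam (dn U2))^t* *m Gam (dn (U2 *m T)).
Proof.
move=> iso_1 iso_2; move: T.
apply: (isometry_span (@iso1 C m)) => [c u v Eu Ev | T isoT].
  by rewrite !mulmxDr -!scalemxAr up_linear dn_linear !Gam_linear !mulmxDr -!scalemxAr Eu Ev.
have [c [s [cr sr cs cs0]]] := pythagorean C.
have iso1T := iso_mul iso_1 isoT; have iso2T := iso_mul iso_2 isoT.
have A1 : isometry (c *: up p U1 + s *: dn U2).
  by apply: iso_comb; rewrite ?cr ?sr //; [exact: iso_up | exact: iso_dn | exact: up_dn_orth].
have A2 : isometry (s *: up p (U1 *m T) + (- c) *: dn (U2 *m T)).
  apply: iso_comb; [exact: iso_up | exact: iso_dn | exact: up_dn_orth |].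
  by rewrite rmorphN /= mulrNN cr sr addrC.
have A12 : (c *: up p U1 + s *: dn U2)^t* *m (s *: up p (U1 *m T) + (- c) *: dn (U2 *m T)) = 0.
  rewrite !(adjD, adjZ, mulmxDl, mulmxDr, =^~ scalemxAl, =^~ scalemxAr) cr sr.
  rewrite !adj_col_mx !(adj0, mul0mx, mulmx0, addr0, add0r) !mulmxA iso_1 iso_2 !mul1mx.
  by rewrite !scaler0 addr0 add0r !scalerA -scalerDl mulrN [s * c]mulrC subrr scale0r.
have := Gam_orth A1 A2 A12 (Gam_comb _ _ iso_1 iso_2) (Gam_comb _ _ iso1T iso2T).
rewrite !(linD _ _ Gam_linear) !(linZ _ _ Gam_linear).
rewrite !(adjD, adjZ, mulmxDl, mulmxDr, =^~ scalemxAl, =^~ scalemxAr) cr sr.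
rewrite Gam_orth_ud Gam_orth_du !scaler0 addr0 add0r !scalerA mulrN [s * c]mulrC scaleNr.
by move=> /eqP; rewrite subr_eq0 => /eqP/(scalerI cs0).
Qed.

Lemma gram_up U T : isometry U -> (Gam (up p U))^t* *m Gam (up p (U *m T)) = gram T.
Proof.
move=> isoU; rewrite (Gram_transport T isoU (isoB o)).
by rewrite -(Gram_transport T (@iso1 C m) (isoB o)) mul1mx.
Qed.

Lemma gram_dn U T : isometry U -> (Gam (dn U))^t* *m Gam (dn (U *m T)) = gram T.
Proof. by move=> isoU; rewrite -(Gram_transport T (@iso1 C m) isoU) mul1mx. Qed.

(** The k + 1 images are isometries with orthogonal ranges of dimension m, and
    n = (k + 1) m. *)
Lemma Gam_resolution U : isometry U -> Gam (up p U) *m (Gam (up p U))^t* +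
  \sum_i Gam (dn (B i)) *m (Gam (dn (B i)))^t* = 1%:M.
Proof.
move=> isoU.
pose Q (i : 'I_k.+1) :=
  if unlift ord0 i is Some j then Gam (dn (B j)) else Gam (up p U).
have isoQ i : isometry (Q i).
  rewrite /Q; case: unliftP => [j _|_]; apply: Gam_iso.
  - exact: iso_dn.
  - exact: Gam_dd.
  - exact: iso_up.
  - exact: Gam_uu.
have orthQ i j : i != j -> (Q i)^t* *m Q j = 0.
  rewrite /Q; case: unliftP => [i' ->|->]; case: unliftP => [j' ->|->] //.
  - rewrite (inj_eq lift_inj) => ij; apply: Gam_orth.
    + exact: iso_dn.
    + exact: iso_dn.
    + by rewrite adj_col_mx orthB // mulmx0 add0r.
    + exact: Gam_dd.
    + exact: Gam_dd.
  - by rewrite Gam_orth_du.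
  - by rewrite Gam_orth_ud.
have := frame_complete (Q := Q); rewrite card_ord mulSn -pkm => /(_ erefl isoQ orthQ).
rewrite big_ord_recl {1 2}/Q unlift_none => <-; congr (_ + _).
by apply: eq_bigr => i _; rewrite /Q liftK.
Qed.

Lemma Gam_up_mul U T : isometry U -> Gam (up p (U *m T)) = Gam (up p U) *m gram T.
Proof.
move=> isoU; rewrite -[LHS]mul1mx -(Gam_resolution isoU) mulmxDl -mulmxA gram_up //.
rewrite mulmx_suml big1 ?addr0 // => i _.
by rewrite -mulmxA Gam_orth_du mulmx0.
Qed.

Lemma Gam_dn_mul i T : Gam (dn (B i *m T)) = Gam (dn (B i)) *m gram T.
Proof.
rewrite -[LHS]mul1mx -(Gam_resolution (@iso1 C m)) mulmxDl -mulmxA Gam_orth_ud mulmx0 add0r.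
rewrite mulmx_suml (bigD1 i) //= big1 => [|j ji]; first by rewrite -mulmxA gram_dn ?addr0.
rewrite -mulmxA (_ : _ *m Gam _ = 0) ?mulmx0 //.
move: T; apply: (isometry_span (@iso1 C m)) => [c u v Eu Ev | T isoT].
  by rewrite mulmxDr -scalemxAr dn_linear Gam_linear mulmxDr -scalemxAr Eu Ev scaler0 addr0.
have isoBT := iso_mul (isoB i) isoT.
apply: Gam_orth; [exact: iso_dn | exact: iso_dn | | exact: Gam_dd | exact: Gam_dd].
by rewrite adj_col_mx mulmxA orthB // mul0mx mulmx0 addr0.
Qed.

Lemma gram_linear : linear gram.
Proof. by move=> c u v; rewrite /gram up_linear Gam_linear mulmxDr -scalemxAr. Qed.

Lemma gram_inner : exists2 W : 'M[C]_m, isometry W & forall A, gram A = W *m A *m W^t*.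
Proof.
have G1 U : Gam (up p U) = Gam (up p 1%:M) *m gram U.
  by rewrite -{1}[U]mul1mx Gam_up_mul //; exact: iso1.
have iso0 : isometry (Gam (up p 1%:M)).
  by apply: Gam_iso; [apply/iso_up/iso1 | apply/Gam_uu/iso1].
apply: unital_hom_inner => //; first exact: gram_linear.
  move=> A A'; move: A.
  apply: (isometry_span (@iso1 C m)) => [c u v Eu Ev | U isoU].
    by rewrite mulmxDl -scalemxAl !gram_linear Eu Ev mulmxDl -scalemxAl.
  by rewrite {1}/gram Gam_up_mul // mulmxA.
move=> U isoU; have := Gam_iso (iso_up p isoU) (Gam_uu isoU).
by rewrite G1 /isometry adjM mulmxA -(mulmxA ((gram U)^t*)) iso0 mulmx1.
Qed.

Lemma Gam_unitary : exists (V : 'M[C]_n) (W : 'M[C]_m),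
  [/\ isometry V, isometry W & forall A, Gam A = V *m A *m W].
Proof.
have [W isoW FW] := gram_inner; have WW : W *m W^t* = 1%:M by apply: mulmx1C.
have sumB : \sum_i B i *m (B i)^t* = 1%:M.
  by apply: frame_complete; rewrite ?card_ord.
pose C0 := Gam (up p 1%:M); pose Ci i := Gam (dn (B i)).
pose V := row_mx (C0 *m W) (\sum_i Ci i *m W *m (B i)^t*).
exists V, (W^t*); split.
- apply: mulmx1C; rewrite tr_row_mx map_col_mx mul_row_col -(Gam_resolution (@iso1 C m)).
  congr (_ + _); first by rewrite adjM mulmxA -(mulmxA C0) WW mulmx1.
  rewrite adj_sum mulmx_suml; apply: eq_bigr => i _; rewrite mulmx_sumr (bigD1 i) //=.
  rewrite big1 => [|j ji]; rewrite !adjM trmxCK !mulmxA -(mulmxA _ ((B i)^t*)).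
    by rewrite isoB mulmx1 -(mulmxA (Ci i)) WW mulmx1 addr0.
  by rewrite orthB 1?eq_sym // mulmx0 !mul0mx.
- by rewrite /isometry trmxCK.
move=> A; rewrite -[A]vsubmxK /V mul_row_col mulmxDl.
have -> : col_mx (usubmx A) (dsubmx A) = up p (usubmx A) + dn (dsubmx A).
  by rewrite add_col_mx addr0 add0r.
rewrite (linD _ _ Gam_linear); congr (_ + _).
  by rewrite -[usubmx A]mul1mx Gam_up_mul ?FW ?mul1mx ?mulmxA //; exact: iso1.
rewrite -{1}[dsubmx A]mul1mx -sumB !mulmx_suml.
have Gs (G : 'I_k -> 'M[C]_(p, m)) : Gam (dn (\sum_i G i)) = \sum_i Gam (dn (G i)).
  apply: (big_morph (fun N => Gam (dn N))) => [u v|].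
    by rewrite (linD _ _ (@dn_linear C m p)) (linD _ _ Gam_linear).
  by rewrite (lin0 (@dn_linear C m p)) (lin0 Gam_linear).
rewrite Gs; apply: eq_bigr => i _.
by rewrite -mulmxA Gam_dn_mul FW !mulmxA.
Qed.

Lemma iso_scale q (M : 'M[C]_(q, m)) t : M != 0 -> M^t* *m M = t *: 1%:M ->
  exists c (U : 'M_(q, m)), [/\ isometry U, M = c *: U & c * c^* = t].
Proof.
move=> M0 Mt; pose i := Ordinal m_gt0.
have t0 : 0 <= t.
  have -> : t = ((col i M)^t* *m col i M) 0 0.
    have := congr1 (fun X : 'M_m => X i i) Mt; rewrite !mxE eqxx mulr1 => <-.
    by apply: eq_bigr => j _; rewrite !mxE.
  exact: adj_mul_ge0.
have tn0 : t != 0.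
  by apply: contra_neq M0 => t0'; apply: adj_mul_eq0; rewrite Mt t0' scale0r.
have s0 : sqrtC t != 0 by rewrite sqrtC_eq0.
have sr : (sqrtC t)^* = sqrtC t by rewrite conj_Creal // ger0_real // sqrtC_ge0.
exists (sqrtC t), ((sqrtC t)^-1 *: M); split; last by rewrite sr -expr2 sqrtCK.
  rewrite /isometry adjZ fmorphV /= sr -scalemxAl -scalemxAr scalerA Mt scalerA.
  by rewrite -invfM -expr2 sqrtCK mulVf // scale1r.
by rewrite scalerA mulfV // scale1r.
Qed.

(** Let A = up M + dn N.  The operators obtained from z M in place of M form a pencil as in
    [rank_one_pencil], so Phi (dyad A A) = dyad (Gam A') (Gam A') with
    A' = x up M + y dn N, x y^* = 1, and A' is an isometry.  Comparing
    M^* M + N^* N = 1 with |x|^2 M^* M + |y|^2 N^* N = 1, either |x| = |y| = 1, or M^* M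
    and N^* N are scalar and [Gam_comb] applies. *)
Lemma Gam_dyad A : isometry A -> S A A = dyad (Gam A) (Gam A).
Proof.
have [V [W [isoV isoW GE]]] := Gam_unitary.
have WW : W *m W^t* = 1%:M by apply: mulmx1C.
have GK X : X = V^t* *m Gam X *m W^t*.
  by rewrite GE !mulmxA isoV mul1mx -mulmxA WW mulmx1.
have Ginj X : Gam X = 0 -> X = 0.
  by move=> X0; rewrite [X]GK X0 mulmx0 mul0mx.
have Giso X : isometry (Gam X) -> isometry X.
  move=> isoX; rewrite [X]GK; apply: iso_mul; last by rewrite /isometry trmxCK.
  by apply: iso_mul => //; rewrite /isometry trmxCK; apply: mulmx1C.
move=> isoA; pose M := usubmx A; pose N := dsubmx A.
have colE x y : col_mx (x *: M) (y *: N) = x *: up p M + y *: dn N.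
  by rewrite -(linZ _ _ (@up_linear C m p)) -(linZ _ _ (@dn_linear C m p)) add_col_mx addr0 add0r.
have AE : A = up p M + dn N by rewrite add_col_mx addr0 add0r vsubmxK.
have MN : M^t* *m M + N^t* *m N = 1%:M by rewrite -adj_col_mx vsubmxK.
have [M0|M0] := eqVneq M 0.
  have -> : A = dn N by rewrite AE M0 (lin0 (@up_linear C m p)) add0r.
  by apply: Gam_dd; rewrite /isometry -MN M0 mulmx0 add0r.
have [N0|N0] := eqVneq N 0.
  have -> : A = up p M by rewrite AE N0 (lin0 (@dn_linear C m p)) addr0.
  by apply: Gam_uu; rewrite /isometry -MN N0 mulmx0 addr0.
pose g := vec (Gam (up p M)); pose h := vec (Gam (dn N)).
have gh : indep g h.
  move=> x y; rewrite -!(linZ _ _ (@vec_linear C m n)) -(linD _ _ (@vec_linear C m n)).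
  rewrite -(vec0 C m n) => /vec_inj; rewrite -!(linZ _ _ Gam_linear) -(linD _ _ Gam_linear).
  move=> /Ginj/eqP; rewrite -colE col_mx_eq0 !scaler_eq0 (negPf M0) (negPf N0) !orbF.
  by case/andP=> /eqP -> /eqP ->.
pose D := S (up p M) (up p M) + S (dn N) (dn N).
have Sz z : z * z^* = 1 ->
    S (z *: up p M + 1 *: dn N) (z *: up p M + 1 *: dn N) =
    D + (z *: (g *m h^t*) + z^* *: (h *m g^t*)).
  move=> zz; rewrite /S dyad_sum !(linearD, linearZ) /= -!/(S _ _) Gam_ud Gam_du.
  by rewrite zz conjC1 !mulr1 !scale1r.
have [x [y [xy DE]]] : exists x y, x * y^* = 1 /\
    D = (x * x^*) *: (g *m g^t*) + (y * y^*) *: (h *m h^t*).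
  apply: rank_one_pencil => // z zz; rewrite -Sz //.
  have isoz : isometry (z *: up p M + 1 *: dn N).
    rewrite -colE /isometry adj_col_mx scale1r adjZ -scalemxAl -scalemxAr scalerA.
    by rewrite [z^* * z]mulrC zz scale1r.
  by have [E _ SE] := iso_preserver_image PhiP isoz; exists (vec E).
have xy' : x^* * y = 1 by rewrite -[y]conjCK -rmorphM xy rmorph1.
have SA : S A A = dyad (Gam (x *: up p M + y *: dn N)) (Gam (x *: up p M + y *: dn N)).
  rewrite (linD _ _ Gam_linear) !(linZ _ _ Gam_linear) dyad_sum -/g -/h /dyad -/g -/h -DE.
  rewrite xy xy'; have := Sz 1; rewrite conjC1 mulr1 => /(_ erefl) <-.
  by rewrite !scale1r -AE.
have isoxy : isometry (x *: up p M + y *: dn N).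
  have [E isoE SE] := iso_preserver_image PhiP isoA.
  by apply: Giso; apply: (iso_dyad isoE); rewrite -SA.
(* either the weights are trivial, or both blocks are multiples of isometries *)
pose al := x * x^*; pose be := y * y^*.
have albe : al * be = 1.
  by rewrite /al /be mulrACA [x * y]mulrC; transitivity ((x * y^*) * (x^* * y)); [ring|rewrite xy xy' mulr1].
have E1 : al *: (M^t* *m M) + be *: (N^t* *m N) = 1%:M.
  move: isoxy; rewrite -colE /isometry adj_col_mx !adjZ -!scalemxAl -!scalemxAr !scalerA.
  by rewrite ![_^* * _]mulrC.
have E2 : (al - be) *: (M^t* *m M) = (1 - be) *: 1%:M.
  rewrite -MN in E1 *; rewrite scalerBl scalerBl scale1r scalerDr -{1}E1.
  by apply/matrixP => i j; rewrite !mxE; ring.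
have [ab|ab] := eqVneq al be.
  have al1 : al = 1.
    have al_ge0 : 0 <= al by exact: mul_conjC_ge0.
    apply/eqP; rewrite -(@eqrXn2 _ 2) ?ler01 // expr1n expr2 {2}ab albe //.
  have be1 : be = 1 by rewrite -ab.
  have -> : S A A = D + (g *m h^t* + h *m g^t*).
    by have := Sz 1; rewrite conjC1 mulr1 => /(_ erefl); rewrite !scale1r -AE.
  rewrite DE -/al -/be al1 be1 [in RHS]AE -[up p M]scale1r -[dn N]scale1r.
  rewrite (linD _ _ Gam_linear) !(linZ _ _ Gam_linear) dyad_sum /dyad -/g -/h.
  by rewrite !conjC1 !mulr1 !scale1r.
have ab0 : al - be != 0 by rewrite subr_eq0.
have MM : M^t* *m M = ((al - be)^-1 * (1 - be)) *: 1%:M.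
  by rewrite -scalerA -E2 scalerK.
have NN : N^t* *m N = (1 - (al - be)^-1 * (1 - be)) *: 1%:M.
  by rewrite scalerBl scale1r -MM -MN [X in X - _]addrC addrK.
have [c [U [isoU MU cc]]] := iso_scale M0 MM.
have [s [U' [isoU' NU ss]]] := iso_scale N0 NN.
rewrite AE MU NU (linZ _ _ (@up_linear C m p)) (linZ _ _ (@dn_linear C m p)).
exact: Gam_comb.
Qed.

End Gamma.

(** * Proof of the theorem *)

Section Assembly.
Variable C : numClosedFieldType.

Definition block_col k m (i : 'I_k) : 'M[C]_(k * m, m) :=
  \matrix_(s, j) (s == mxtens_index (i, j))%:R.

Lemma block_col_mul k m (i j : 'I_k) :
  (block_col m i)^t* *m block_col m j = ((i == j)%:R)%:M.
Proof.
apply/matrixP => a b; rewrite !mxE (bigD1 (mxtens_index (j, b))) //=.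
rewrite big1 => [|s sj]; last by rewrite !mxE (negPf sj) mulr0.
rewrite !mxE eqxx mulr1 addr0 conjC_nat (can_eq (@mxtens_indexK k m)) xpair_eqE eq_sym.
by rewrite [b == a]eq_sym; case: (i == j); case: (a == b).
Qed.

Lemma block_col_iso k m (i : 'I_k) : isometry (block_col m i).
Proof. by rewrite /isometry block_col_mul eqxx. Qed.

Lemma block_col_orth k m (i j : 'I_k) : i != j -> (block_col m i)^t* *m block_col m j = 0.
Proof. by move=> ij; rewrite block_col_mul (negPf ij) raddf0. Qed.

Lemma left_preserver m k
    (Phi : {linear 'M[C]_(m * (m + k * m)) -> 'M[C]_(m * (m + k * m))})
    (a : 'cV_(m * (m + k * m))) :
  (0 < m)%N -> (0 < k)%N -> iso_preserver Phi ->
  Phi (dyad (up _ 1%:M) (up _ 1%:M)) = a *m a^t* ->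
  (forall N, exists b : 'cV_(m * (m + k * m)), Phi (dyad (up _ 1%:M) (dn N)) = a *m b^t*) ->
  exists V W, [/\ isometry V, isometry W & forall A : 'M_(m + k * m, m), isometry A ->
     Phi (dyad A A) = dyad (V *m A *m W) (V *m A *m W)].
Proof.
move=> m0 k0 PhiP Sa left_type.
have isoB := @block_col_iso k m; pose o : 'I_k := Ordinal k0.
have [Gam [lG ud du uu dd]] := left_type_gamma m0 PhiP (isoB o) Sa left_type.
have orthB := @block_col_orth k m.
have [V [W [isoV isoW GE]]] := Gam_unitary m0 PhiP erefl o isoB orthB lG ud du uu dd.
exists V, W; split=> // A isoA; rewrite -GE.
exact: (Gam_dyad m0 PhiP erefl o isoB orthB lG ud du uu dd).
Qed.

(** In the right-handed case the composition of Phi with the transposition, which maps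
    dyads of isometries to dyads of their conjugates, is left-handed. *)
Lemma dyad_preserver m k
    (Phi : {linear 'M[C]_(m * (m + k * m)) -> 'M[C]_(m * (m + k * m))}) :
  (0 < m)%N -> (0 < k)%N -> iso_preserver Phi ->
  exists V W, [/\ isometry V, isometry W &
    (forall A : 'M_(m + k * m, m), isometry A ->
       Phi (dyad A A) = dyad (V *m A *m W) (V *m A *m W)) \/
    (forall A : 'M_(m + k * m, m), isometry A ->
       Phi (dyad A A) = (dyad (V *m A *m W) (V *m A *m W))^T)].
Proof.
move=> m0 k0 PhiP.
have isoJ := @block_col_iso k m (Ordinal k0).
have [a Sa] := up_image PhiP (@iso1 C m).
have [left_type|right_type] := left_or_right m0 PhiP isoJ (@iso1 C m) Sa.
  have [V [W [isoV isoW VW]]] := left_preserver m0 k0 PhiP Sa left_type.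
  by exists V, W; split=> //; left.
pose Psi : {linear 'M[C]_(m * (m + k * m)) -> 'M[C]_(m * (m + k * m))} := trmx \o Phi.
have PsiP : iso_preserver Psi.
  split=> [X SX /(congr1 trmx)|A].
    by rewrite /= trmxK trmx0; apply: (iso_preserver_inj PhiP).
  move=> /(iso_preserver_image PhiP)[B isoB E].
  by exists (map_mx Num.conj B); [exact: conj_iso | rewrite /= E dyad_tr].
have tr_outer d (u w : 'cV[C]_d) : (u *m w^t*)^T = map_mx Num.conj w *m (map_mx Num.conj u)^t*.
  by rewrite trmx_mul tr_adj adj_conj.
have [||V [W [isoV isoW VW]]] :=
    left_preserver (Phi := Psi) (a := map_mx Num.conj a) m0 k0 PsiP.
- by rewrite /= Sa tr_outer.
- by move=> N; have [b Nb] := right_type N; exists (map_mx Num.conj b); rewrite /= Nb tr_outer.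
exists V, W; split=> //; right => A isoA.
by rewrite -VW //= trmxK.
Qed.
End Assembly.

(** The sum of the x_j (x) y_j is vec A with A = sum_j y_j x_j^T, and A is an isometry because
    the x_j, m of them, form an orthonormal basis of C^m. *)
Lemma MES_dyad (R : realType) m n (hm : (0 < m)%N) (X : 'M[R[i]]_(m * n)) :
  MES R m n X <-> exists2 A : 'M[R[i]]_(n, m), isometry A & X = m%:R^-1 *: dyad A A.
Proof.
have cr : (sqrtC m%:R : R[i])^* = sqrtC m%:R.
  by rewrite conj_Creal // ger0_real // sqrtC_ge0 ler0n.
have outer (A : 'M[R[i]]_(n, m)) : ((sqrtC m%:R)^-1 *: vec A) *m
    adjoint ((sqrtC m%:R)^-1 *: vec A) = m%:R^-1 *: dyad A A.
  rewrite -[adjoint _]/(_^t*) adjZ fmorphV /= cr -scalemxAl -scalemxAr scalerA.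
  by rewrite -invfM -expr2 sqrtCK.
have vec_sum (I : finType) (F : I -> 'M[R[i]]_(n, m)) : vec (\sum_i F i) = \sum_i vec (F i).
  by apply: (big_morph _ (fun u v => linD u v (@vec_linear R[i] m n)) (lin0 (@vec_linear R[i] m n))).
have scaleN (x : 'I_m -> 'cV[R[i]]_m) (y : 'I_m -> 'cV[R[i]]_n) :
    \sum_(j < m) (sqrtC m%:R)^-1 *: (tensmx (x j) (y j) : 'cV_(m * n)) =
    (sqrtC m%:R)^-1 *: vec (\sum_j y j *m (x j)^T).
  by rewrite -scaler_sumr vec_sum; under eq_bigr do rewrite tensmx_outer.
split=> [[u [x [y [ox oy ->]]] ->] | [A isoA ->]].
  exists (\sum_j y j *m (x j)^T); last by rewrite scaleN outer.
  have xx i j : (x i)^t* *m x j = ((i == j)%:R)%:M by rewrite [LHS]mx11_scalar; congr _%:M; apply: ox.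
  have yy i j : (y i)^t* *m y j = ((i == j)%:R)%:M by rewrite [LHS]mx11_scalar; congr _%:M; apply: oy.
  have Qx : \sum_j map_mx Num.conj (x j) *m (map_mx Num.conj (x j))^t* = 1%:M.
    apply: frame_complete; first by rewrite card_ord muln1.
      by move=> i; apply: conj_iso; rewrite /isometry xx eqxx.
    move=> i j ij; rewrite (_ : _^t* = map_mx Num.conj ((x i)^t*)); last first.
      by apply/matrixP => a b; rewrite !mxE.
    by rewrite -map_mxM xx (negPf ij) raddf0 map_mx0.
  rewrite /isometry -{}[RHS]Qx adj_sum mulmx_suml; apply: eq_bigr => i _.
  rewrite mulmx_sumr (bigD1 i) //= big1 => [|j ji].
    rewrite adjM mulmxA -(mulmxA _ ((y i)^t*)) yy eqxx mulmx1 addr0.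
    by congr (_ *m _); apply/matrixP => a b; rewrite !mxE ?conjCK.
  by rewrite adjM mulmxA -(mulmxA _ ((y i)^t*)) yy eq_sym (negPf ji) raddf0 mulmx0 mul0mx.
exists ((sqrtC m%:R)^-1 *: vec A); last by rewrite outer.
exists (fun j => delta_mx j 0), (fun j => col j A); split.
- move=> i j; rewrite -[adjoint _]/(_^t*) -colE !mxE eqxx andbT conjC_nat eq_sym //.
- move=> i j; have := congr1 (fun M : 'M_m => M i j) isoA; rewrite !mxE => <-.
  by apply: eq_bigr => k _; rewrite !mxE.
rewrite scaleN; congr (_ *: vec _); rewrite -{1}[A]mulmx1.
apply/matrixP => a b; rewrite summxE (bigD1 b) //= big1 => [|j jb].
  by rewrite mulmx1 !mxE big_ord1 !mxE !eqxx mulr1 addr0.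
by rewrite !mxE big_ord1 !mxE andbT [b == j]eq_sym (negPf jb) mulr0.
Qed.

Theorem theorem1p1 (R : realType) (m k : nat) (hm : (0 < m)%N) (hk : (1 < k)%N)
    (Phi : 'M[R[i]]_(m * (k * m)) -> 'M[R[i]]_(m * (k * m)))
    (Phi_lin : linear_on (lspan (MES R m (k * m))) Phi)
    (Phi_inv : set_bij (lspan (MES R m (k * m))) (lspan (MES R m (k * m))) Phi)
    (Phi_MES : Phi @` MES R m (k * m) `<=` MES R m (k * m)) :
  exists (U : 'M[R[i]]_m) (V : 'M[R[i]]_(k * m))
      (sigma : 'M[R[i]]_(m * (k * m)) -> 'M[R[i]]_(m * (k * m))),
    [/\ U \is unitarymx,
        V \is unitarymx,
        (forall A, sigma A = A) \/ (forall A, sigma A = A^T) &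
        forall X, lspan (MES R m (k * m)) X ->
          Phi X = tensmx U V *m sigma X *m adjoint (tensmx U V)].
Proof.
case: k hk Phi Phi_lin Phi_inv Phi_MES => [//|k] hk Phi Phi_lin [_ Phi_inj _] Phi_MES.
have k0 : (0 < k)%N by [].
set Sp := lspan (MES R m (k.+1 * m)).
have Spc : lin_closed Sp by exact: lspan_closed.
(* outside the span Phi is arbitrary: a linear f with the same values on it replaces Phi *)
have [f fE] := extend_linear (lspan0 _) Spc Phi_lin.
have m0 : (m%:R : R[i]) != 0 by rewrite pnatr_eq0 -lt0n.
have SpM A : isometry A -> MES R m (k.+1 * m) (m%:R^-1 *: dyad A A).
  by move=> isoA; apply/(MES_dyad hm); exists A.
have Spd X : lspan (@iso_dyads R[i] m (k.+1 * m)) X -> Sp X.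
  apply: lspan_ind => //; first exact: lspan0.
  move=> _ [A isoA ->]; rewrite -[dyad A A](scalerKV m0).
  by apply: lin_closedZ => //; apply: lspan_gen; apply: SpM.
have fP : iso_preserver f.
  split=> [X /Spd SX fX|A isoA].
    by apply: Phi_inj; rewrite ?inE //; [exact: lspan0 | rewrite -!fE // ?fX ?linear0 //; exact: lspan0].
  have /(MES_dyad hm)[B isoB E] : MES R m (k.+1 * m) (Phi (m%:R^-1 *: dyad A A)).
    by apply: Phi_MES; exists (m%:R^-1 *: dyad A A) => //; apply: SpM.
  exists B => //; move: E; rewrite -fE; last exact/lspan_gen/SpM.
  by rewrite linearZ /= => /(scalerI (invr_neq0 m0)).
have [V [W [isoV isoW VW]]] := dyad_preserver hm k0 fP.
have unitV : V \is unitarymx by apply/unitarymxP/mulmx1C.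
have unitW : W^T \is unitarymx by rewrite trmx_unitary; apply/unitarymxP/mulmx1C.
pose L := tensmx W^T V.
have Ldyad A : dyad (V *m A *m W) (V *m A *m W) = L *m dyad A A *m L^t*.
  by rewrite /dyad -[W in V *m A *m W]trmxK -!vec_mul adjM !mulmxA.
have extend U' V' (sigma : 'M[R[i]]_(m * (k.+1 * m)) -> 'M[R[i]]_(m * (k.+1 * m))) :
    (forall c X Y, sigma (c *: X + Y) = c *: sigma X + sigma Y) ->
    (forall A, isometry A ->
       f (dyad A A) = tensmx U' V' *m sigma (dyad A A) *m (tensmx U' V')^t*) ->
    forall X, Sp X -> Phi X = tensmx U' V' *m sigma X *m adjoint (tensmx U' V').
  move=> ls fA X SX; rewrite -fE // -[adjoint _]/(_^t*).
  have lsn : linear sigma by exact: ls.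
  move: X SX; apply: lspan_ind => [c X Y EX EY||X /(MES_dyad hm)[A isoA ->]].
  - by rewrite linearP EX EY ls mulmxDr mulmxDl -scalemxAr -scalemxAl.
  - by rewrite linear0 (lin0 lsn) mulmx0 mul0mx.
  by rewrite linearZ /= fA // (linZ _ _ lsn) -scalemxAr -scalemxAl.
case: VW => VW.
  exists W^T, V, id; split=> //; first by left.
  by apply: extend => // A isoA; rewrite VW // Ldyad.
(* (L X L^* )^T is the conjugation of X^T by the complex conjugate of L *)
exists (map_mx Num.conj W^T), (map_mx Num.conj V), trmx; split.
- by rewrite conjC_unitary.
- by rewrite conjC_unitary.
- by right.
apply: extend => [c X Y|A isoA]; first by rewrite linearP.
rewrite VW // Ldyad -map_mxT -/L !trmx_mul mulmxA.
by rewrite tr_adj adj_conj.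
Qed.
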